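(* Let $K$ be a field of characteristic $0$, $n\ge 2$, $P_0=K[x_1,\dots,x_n]$, $P=P_0[y_1,\dots,y_n]$ bigraded by $\deg x_i=(1,0)$, $\deg y_i=(0,1)$, and $P_+=(y_1,\dots,y_n)$. Let $r\ge 1$ be an integer and, for $\lambda=(\lambda_1,\dots,\lambda_n)\in K^n$, let $f_\lambda=\sum_{i=1}^n\lambda_i x_iy_i$. Then there exists a nonempty Zariski open subset $V\subset K^n$ such that for all $\lambda\in V$ and all $j\le -n$, $$\operatorname{reg} H^n_{P_+}(P/f_\lambda^rP)_j=-n-j+r-1 .$$
   Context: For a bigraded $P$-module $N$, $N_j=\bigoplus_i N_{(i,j)}$ is a graded $P_0$-module with $(N_j)_i=N_{(i,j)}$. $H^n_{P_+}$ is local cohomology with its natural bigrading; each $H^n_{P_+}(P/f_\lambda^rP)_j$ is a finitely generated graded $P_0$-module. $\operatorname{reg}$ denotes Castelnuovo-Mumford regularity over $P_0$: $\operatorname{reg} N=\max_{i,k}\{a_{ik}-i\}$ if $N\neq 0$ has minimal graded free resolution with $i$-th module $\bigoplus_kP_0(-a_{ik})$. *)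

(* Defs.v *)
From HB Require Import structures.
From mathcomp Require Import all_boot all_order all_algebra.
From mathcomp Require Import boolp.
From mathcomp Require Import mpoly.
From mathcomp Require Import zify.

Set Implicit Arguments.
Unset Strict Implicit.
Unset Printing Implicit Defensive.

Import GRing.Theory.

Local Open Scope ring_scope.
Local Open Scope quotient_scope.

Inductive span (R : nzRingType) (M : lmodType R) (N : M -> Prop) : M -> Prop :=
  | span0 : span N 0
  | span_mem x of N x : span N x
  | spanD x y of span N x & span N y : span N (x + y)
  | spanZ (a : R) x of span N x : span N (a *: x).

Section QuotMod.
Variables (R : nzRingType) (M : lmodType R) (N : M -> Prop).

Definition quot_rel : rel M := fun x y => `[< span N (x - y) >].

Fact quot_rel_equiv : equiv_class_of quot_rel.
Proof.
have spanN x : span N x -> span N (- x).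
  by move=> Nx; rewrite -scaleN1r; apply: spanZ.
split=> [x|x y|y x z]; first by apply/asboolP; rewrite subrr; apply: span0.
  by apply/asboolP/asboolP => /spanN; rewrite opprB.
move=> /asboolP Nxy /asboolP Nyz; apply/asboolP.
by rewrite -(subrKA y); apply: spanD.
Qed.

Canonical quot_equiv := EquivRelPack quot_rel_equiv.

Definition quotmod := {eq_quot quot_equiv}.

HB.instance Definition _ := Choice.on quotmod.

Definition quotpi (x : M) : quotmod := \pi_{eq_quot quot_equiv} x.
Definition quotrepr (u : quotmod) : M := repr (u : {eq_quot quot_equiv}).

Lemma quotpiP x y : quotpi x = quotpi y <-> span N (x - y).
Proof. by split=> [/eqmodP/asboolP | ?] //; apply/eqmodP/asboolP. Qed.

Lemma quotreprK : cancel quotrepr quotpi.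
Proof. by move=> u; apply: reprK. Qed.

Lemma quotpi_ind (Q : quotmod -> Prop) :
  (forall x, Q (quotpi x)) -> forall u, Q u.
Proof. by move=> Qpi u; rewrite -(quotreprK u). Qed.

Definition quot_opp u := quotpi (- quotrepr u).
Definition quot_add u v := quotpi (quotrepr u + quotrepr v).
Definition quot_scale (a : R) u := quotpi (a *: quotrepr u).

Lemma quot_oppE x : quot_opp (quotpi x) = quotpi (- x).
Proof.
apply/quotpiP; rewrite -opprD -[X in span _ X]scaleN1r; apply: spanZ.
by apply/quotpiP; rewrite quotreprK.
Qed.

Lemma quot_addE x y : quot_add (quotpi x) (quotpi y) = quotpi (x + y).
Proof.
apply/quotpiP; rewrite opprD addrACA.
by apply: spanD; apply/quotpiP; rewrite quotreprK.
Qed.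

Lemma quot_scaleE a x : quot_scale a (quotpi x) = quotpi (a *: x).
Proof.
apply/quotpiP; rewrite -scalerBr; apply: spanZ.
by apply/quotpiP; rewrite quotreprK.
Qed.

Fact quot_addA : associative quot_add.
Proof.
elim/quotpi_ind=> x; elim/quotpi_ind=> y; elim/quotpi_ind=> z.
by rewrite !quot_addE addrA.
Qed.

Fact quot_addC : commutative quot_add.
Proof.
by elim/quotpi_ind=> x; elim/quotpi_ind=> y; rewrite !quot_addE addrC.
Qed.

Fact quot_add0 : left_id (quotpi 0) quot_add.
Proof. by elim/quotpi_ind=> x; rewrite quot_addE add0r. Qed.

Fact quot_addN : left_inverse (quotpi 0) quot_opp quot_add.
Proof. by elim/quotpi_ind=> x; rewrite quot_oppE quot_addE addNr. Qed.

HB.instance Definition _ :=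
  GRing.isZmodule.Build quotmod quot_addA quot_addC quot_add0 quot_addN.

Fact quot_scaleA a b u :
  quot_scale a (quot_scale b u) = quot_scale (a * b) u.
Proof. by elim/quotpi_ind: u => x; rewrite !quot_scaleE scalerA. Qed.

Fact quot_scale1 : left_id 1 quot_scale.
Proof. by elim/quotpi_ind=> x; rewrite quot_scaleE scale1r. Qed.

Fact quot_scaleDr : right_distributive quot_scale +%R.
Proof.
move=> a; elim/quotpi_ind=> x; elim/quotpi_ind=> y.
by rewrite [quotpi x + _]quot_addE !quot_scaleE [RHS]quot_addE scalerDr.
Qed.

Fact quot_scaleDl u : {morph quot_scale^~ u : a b / a + b}.
Proof.
elim/quotpi_ind: u => x a b.
by rewrite !quot_scaleE [RHS]quot_addE scalerDl.
Qed.

HB.instance Definition _ := GRing.Zmodule_isLmodule.Build R quotmod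
  quot_scaleA quot_scale1 quot_scaleDr quot_scaleDl.

End QuotMod.

Section Localization.
Variables (R : comNzRingType) (M : lmodType R) (s : R).

(* The pair [(x, k)] stands for the fraction [x / s ^ k]. *)
Definition loc_rel : rel (M * nat) := fun p q =>
  `[< exists t, s ^+ (t + q.2) *: p.1 = s ^+ (t + p.2) *: q.1 >].

Lemma scalerX a b (x : M) : s ^+ a *: (s ^+ b *: x) = s ^+ (a + b) *: x.
Proof. by rewrite scalerA exprD. Qed.

Fact loc_rel_equiv : equiv_class_of loc_rel.
Proof.
split=> [[x k]|[x k] [y l]|[y l] [x k] [z m]].
- by apply/asboolP; exists 0%N.
- by apply/asboolP/asboolP => -[t E]; exists t.
move=> /asboolP[t /= E] /asboolP[t' /= E']; apply/asboolP.
exists (t + t' + l)%N => /=.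
have -> : (t + t' + l + m = (t' + m) + (t + l))%N by lia.
have -> : (t + t' + l + k = (t + k) + (t' + l))%N by lia.
by rewrite -scalerX E scalerX addnC -scalerX E' scalerX.
Qed.

Canonical loc_equiv := EquivRelPack loc_rel_equiv.

Definition loc := {eq_quot loc_equiv}.

HB.instance Definition _ := Choice.on loc.

Definition frac (x : M) (k : nat) : loc := \pi_{eq_quot loc_equiv} (x, k).
Definition locrepr (u : loc) : M * nat := repr (u : {eq_quot loc_equiv}).

Lemma fracP x k y l :
  frac x k = frac y l <-> exists t, s ^+ (t + l) *: x = s ^+ (t + k) *: y.
Proof. by split=> [/eqmodP/asboolP | ?] //; apply/eqmodP/asboolP. Qed.

Lemma locreprK u : frac (locrepr u).1 (locrepr u).2 = u.
Proof. by rewrite /frac -surjective_pairing; apply: reprK. Qed.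

Lemma frac_ind (Q : loc -> Prop) : (forall x k, Q (frac x k)) -> forall u, Q u.
Proof. by move=> Qf u; rewrite -(locreprK u). Qed.

Definition loc_opp u := frac (- (locrepr u).1) (locrepr u).2.
Definition loc_add u v :=
  frac (s ^+ (locrepr v).2 *: (locrepr u).1 + s ^+ (locrepr u).2 *: (locrepr v).1)
       ((locrepr u).2 + (locrepr v).2).
Definition loc_scale (a : R) u := frac (a *: (locrepr u).1) (locrepr u).2.

Lemma loc_oppE x k : loc_opp (frac x k) = frac (- x) k.
Proof.
have /fracP[t E] := locreprK (frac x k).
by apply/fracP; exists t; rewrite !scalerN E.
Qed.

Lemma loc_scaleE a x k : loc_scale a (frac x k) = frac (a *: x) k.
Proof.
have /fracP[t E] := locreprK (frac x k).
apply/fracP; exists t; rewrite [LHS]scalerA mulrC -[LHS]scalerA E.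
by rewrite !scalerA mulrC.
Qed.

Lemma loc_addE x k y l :
  loc_add (frac x k) (frac y l) = frac (s ^+ l *: x + s ^+ k *: y) (k + l).
Proof.
have /fracP[t E] := locreprK (frac x k).
have /fracP[t' E'] := locreprK (frac y l).
rewrite /loc_add.
move: (locrepr (frac x k)) (locrepr (frac y l)) E E' => [x' k'] [y' l'] /= E E'.
apply/fracP; exists (t + t')%N; rewrite !scalerDr !scalerX; congr (_ + _).
  have -> : (t + t' + (k + l) + l' = (t' + l + l') + (t + k))%N by lia.
  by rewrite -scalerX E scalerX; congr (s ^+ _ *: _); lia.
have -> : (t + t' + (k + l) + k' = (t + k + k') + (t' + l))%N by lia.
by rewrite -scalerX E' scalerX; congr (s ^+ _ *: _); lia.
Qed.

Fact loc_addA : associative loc_add.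
Proof.
elim/frac_ind=> x k; elim/frac_ind=> y l; elim/frac_ind=> z m.
rewrite !loc_addE !scalerDr !scalerX !addrA addnA; congr frac.
by rewrite [(m + l)%N]addnC [(m + k)%N]addnC.
Qed.

Fact loc_addC : commutative loc_add.
Proof.
by elim/frac_ind=> x k; elim/frac_ind=> y l; rewrite !loc_addE addrC addnC.
Qed.

Fact loc_add0 : left_id (frac 0 0) loc_add.
Proof. by elim/frac_ind=> x k; rewrite loc_addE scaler0 add0r scale1r. Qed.

Fact loc_addN : left_inverse (frac 0 0) loc_opp loc_add.
Proof.
elim/frac_ind=> x k; rewrite loc_oppE loc_addE scalerN addNr.
by apply/fracP; exists 0%N; rewrite !scaler0.
Qed.

HB.instance Definition _ :=
  GRing.isZmodule.Build loc loc_addA loc_addC loc_add0 loc_addN.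

Fact loc_scaleA a b u : loc_scale a (loc_scale b u) = loc_scale (a * b) u.
Proof. by elim/frac_ind: u => x k; rewrite !loc_scaleE scalerA. Qed.

Fact loc_scale1 : left_id 1 loc_scale.
Proof. by elim/frac_ind=> x k; rewrite loc_scaleE scale1r. Qed.

Fact loc_scaleDr : right_distributive loc_scale +%R.
Proof.
move=> a; elim/frac_ind=> x k; elim/frac_ind=> y l.
rewrite [frac x k + _]loc_addE !loc_scaleE [RHS]loc_addE scalerDr !scalerA.
by rewrite ![a * _]mulrC.
Qed.

Fact loc_scaleDl u : {morph loc_scale^~ u : a b / a + b}.
Proof.
elim/frac_ind: u => x k a b.
rewrite !loc_scaleE [RHS]loc_addE -scalerDr -scalerDl.
by apply/fracP; exists 0%N; rewrite scalerX; congr (s ^+ _ *: _); lia.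
Qed.

HB.instance Definition _ := GRing.Zmodule_isLmodule.Build R loc
  loc_scaleA loc_scale1 loc_scaleDr loc_scaleDl.

End Localization.

(* For [s' = t * s], the canonical map sending [x / s ^ k] to
   [(t ^ k *: x) / s' ^ k], whatever the representative: see [locmap_frac]. *)
Definition locmap (R : comNzRingType) (M : lmodType R) (s t s' : R)
    (u : loc M s) : loc M s' :=
  frac s' (t ^+ (locrepr u).2 *: (locrepr u).1) (locrepr u).2.

Lemma locmap_frac (R : comNzRingType) (M : lmodType R) (s t : R) (x : M) k :
  locmap t (t * s) (frac s x k) = frac (t * s) (t ^+ k *: x) k.
Proof.
have /fracP[l E] := locreprK (frac s x k).
rewrite /locmap; move: (locrepr _) E => [x' k'] /= E.
apply/fracP; exists l; rewrite !exprMn !scalerA.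
rewrite [in LHS]mulrAC [in RHS]mulrAC -!exprD -!scalerA E.
by congr (t ^+ _ *: _); lia.
Qed.

Section DepProd.
Variables (R : nzRingType) (I : Type) (M : I -> lmodType R).

Definition dprod := forall i, M i.

HB.instance Definition _ := gen_eqMixin dprod.
HB.instance Definition _ := gen_choiceMixin dprod.

Definition dprod_opp (u : dprod) : dprod := fun i => - u i.
Definition dprod_add (u v : dprod) : dprod := fun i => u i + v i.
Definition dprod_scale (a : R) (u : dprod) : dprod := fun i => a *: u i.

Fact dprod_addA : associative dprod_add.
Proof. by move=> u v w; apply: functional_extensionality_dep => i; apply: addrA. Qed.
Fact dprod_addC : commutative dprod_add.
Proof. by move=> u v; apply: functional_extensionality_dep => i; apply: addrC. Qed.
Fact dprod_add0 : left_id (fun=> 0) dprod_add.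
Proof. by move=> u; apply: functional_extensionality_dep => i; apply: add0r. Qed.
Fact dprod_addN : left_inverse (fun=> 0) dprod_opp dprod_add.
Proof. by move=> u; apply: functional_extensionality_dep => i; apply: addNr. Qed.

HB.instance Definition _ :=
  GRing.isZmodule.Build dprod dprod_addA dprod_addC dprod_add0 dprod_addN.

Fact dprod_scaleA a b u : dprod_scale a (dprod_scale b u) = dprod_scale (a * b) u.
Proof. by apply: functional_extensionality_dep => i; apply: scalerA. Qed.
Fact dprod_scale1 : left_id 1 dprod_scale.
Proof. by move=> u; apply: functional_extensionality_dep => i; apply: scale1r. Qed.
Fact dprod_scaleDr : right_distributive dprod_scale +%R.
Proof. by move=> a u v; apply: functional_extensionality_dep => i; apply: scalerDr. Qed.
Fact dprod_scaleDl u : {morph dprod_scale^~ u : a b / a + b}.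
Proof. by move=> a b; apply: functional_extensionality_dep => i; apply: scalerDl. Qed.

HB.instance Definition _ := GRing.Zmodule_isLmodule.Build R dprod
  dprod_scaleA dprod_scale1 dprod_scaleDr dprod_scaleDl.

End DepProd.

(* [cech y M] is the product over all [S] of the localizations of [M] at
   [\prod_(i in S) y i]; its [k]-cochains are the families vanishing outside
   the sets of cardinality [k]. The local cohomology of [M] with support in the
   ideal generated by [y] is the cohomology of this complex. *)

Section Cech.
Variables (R : comNzRingType) (n : nat) (y : 'I_n -> R) (M : lmodType R).

Definition yprod (S : {set 'I_n}) : R := \prod_(i in S) y i.

Definition cech := dprod (fun S : {set 'I_n} => loc M (yprod S)).

HB.instance Definition _ := GRing.Lmodule.on cech.

Definition cech_diff (c : cech) : cech := fun T =>
  \sum_(i in T) (-1) ^+ #|[set j in T | (j < i)%N]| *: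
     locmap (y i) (yprod T) (c (T :\ i)).

Definition cochain (k : nat) (c : cech) : Prop :=
  forall S : {set 'I_n}, #|S| <> k -> c S = 0.

Definition cocycle (k : nat) (c : cech) : Prop :=
  cochain k c /\ cech_diff c = 0.

Definition coboundary (k : nat) (c : cech) : Prop :=
  exists l b, [/\ l.+1 = k, cochain l b & c = cech_diff b].

End Cech.

Definition restrict (R0 R : nzRingType) (phi : {rmorphism R0 -> R})
  (M : lmodType R) : Type := M.

Section Restrict.
Variables (R0 R : nzRingType) (phi : {rmorphism R0 -> R}) (M : lmodType R).
Local Notation restrict := (restrict phi M).

HB.instance Definition _ := GRing.Zmodule.on restrict.

Definition restrict_scale (a : R0) (x : restrict) : restrict :=
  phi a *: (x : M).

Fact restrict_scaleA a b u :
  restrict_scale a (restrict_scale b u) = restrict_scale (a * b) u.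
Proof. by rewrite /restrict_scale scalerA rmorphM. Qed.
Fact restrict_scale1 : left_id 1 restrict_scale.
Proof. by move=> u; rewrite /restrict_scale rmorph1 scale1r. Qed.
Fact restrict_scaleDr : right_distributive restrict_scale +%R.
Proof. by move=> a u v; apply: scalerDr. Qed.
Fact restrict_scaleDl u : {morph restrict_scale^~ u : a b / a + b}.
Proof. by move=> a b; rewrite /restrict_scale rmorphD scalerDl. Qed.

HB.instance Definition _ := GRing.Zmodule_isLmodule.Build R0 restrict
  restrict_scaleA restrict_scale1 restrict_scaleDr restrict_scaleDl.

End Restrict.

(* A (bi)graded module is given by its homogeneous components, as subsets of an
   ambient module: the module itself is the direct sum of the components, which
   need not be the whole ambient module. *)

Record grmod (R : nzRingType) := GrMod {
  gr_ambient :> lmodType R;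
  gr_comp : int -> gr_ambient -> Prop }.

Record bigrmod (R : nzRingType) := BigrMod {
  bigr_ambient :> lmodType R;
  bigr_comp : int -> int -> bigr_ambient -> Prop }.

(* [K[x_1, ..., x_n]], and [K[x_1, ..., x_n][y_1, ..., y_n]] in which the [x_i]
   are constants. *)
Notation polyx K n := {mpoly K[n]} (only parsing).
Notation polyxy K n := {mpoly {mpoly K[n]}[n]} (only parsing).

Section Bigraded.
Variables (K : fieldType) (n : nat).

Definition varx (i : 'I_n) : polyxy K n := ('X_i)%:MP.
Definition vary (i : 'I_n) : polyxy K n := 'X_i.

Definition bihomog (a b : int) (p : polyxy K n) : Prop :=
  forall my mx : 'X_{1..n}, (p@_my)@_mx != 0 ->
    (mdeg mx)%:Z = a /\ (mdeg my)%:Z = b.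

(* The components below form a bigrading only when [g] is bihomogeneous. *)
Definition bigr_quot (g : polyxy K n) : bigrmod (polyxy K n) :=
  let I (h : (polyxy K n)^o) := h = g in
  @BigrMod _ (quotmod I) (fun a b u => exists2 p, bihomog a b p & u = quotpi I p).

(* [(\prod_(i in S) y_i) ^ k] has bidegree [(0, k * #|S|)]. *)
Definition cech_bihomog (M : bigrmod (polyxy K n)) (a b : int)
    (c : cech vary M) : Prop :=
  forall S : {set 'I_n}, exists (x : M) (k : nat),
    bigr_comp a (b + (k * #|S|)%N%:Z) x /\ c S = frac _ x k.

(* The [k]-th local cohomology of [M] with support in [(y_1, ..., y_n)]: the
   submodule of cocycles modulo coboundaries inside cochains modulo
   coboundaries, together with its bigrading. *)
Definition loccoh (k : nat) (M : bigrmod (polyxy K n)) : bigrmod (polyxy K n) :=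
  let B (c : cech vary M) := coboundary k c in
  @BigrMod _ (quotmod B) (fun a b u =>
    exists c, [/\ cocycle k c, cech_bihomog a b c & u = quotpi B c]).

(* [N_j = \bigoplus_i N_(i, j)], over the ring of constants in the [y_i] *)
Definition ydegree (N : bigrmod (polyxy K n)) (j : int) : grmod (polyx K n) :=
  @GrMod _ (restrict (@mpolyC n (polyx K n)) N) (fun i => @bigr_comp _ N i j).

End Bigraded.

Section Regularity.
Variables (K : fieldType) (n : nat).

Definition xhomog (d : int) (p : polyx K n) : Prop :=
  forall m, m \in msupp p -> (mdeg m)%:Z = d.

(* The [i]-th module is the free module on [res_rank i] generators of degrees
   [res_deg i k]; its elements are row vectors, on which the differentials act
   by multiplication on the right. *)
Record min_free_res (N : grmod (polyx K n)) := MinFreeRes {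
  res_rank : nat -> nat;
  res_deg : forall i, 'I_(res_rank i) -> int;
  res_diff : forall i, 'M[polyx K n]_(res_rank i.+1, res_rank i);
  res_gen : 'I_(res_rank 0) -> N;
  res_aug := fun u : 'rV[polyx K n]_(res_rank 0) => \sum_k u 0 k *: res_gen k;
  res_gen_homog : forall k, gr_comp (res_deg k) (res_gen k);
  res_diff_homog : forall i k l,
    xhomog (res_deg k - res_deg l) (res_diff i k l);
  res_aug_surj : forall d z, @gr_comp _ N d z -> exists u, z = res_aug u;
  res_exact0 : forall u, res_aug u = 0 <-> exists v, u = v *m res_diff 0;
  res_exactS : forall i (u : 'rV_(res_rank i.+1)),
    u *m res_diff i = 0 <-> exists v, u = v *m res_diff i.+1;
  res_minimal : forall i k l, (res_diff i k l)@_0%MM = 0 }.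

(* [reg N = s]; minimal resolutions being unique up to isomorphism, the choice of
   [F] is immaterial. Attainment of the maximum forces [N] to be nonzero. *)
Definition has_reg (N : grmod (polyx K n)) (s : int) : Prop :=
  exists F : min_free_res N,
    (exists i (k : 'I_(res_rank F i)), res_deg k - i%:Z = s) /\
    (forall i (k : 'I_(res_rank F i)), res_deg k - i%:Z <= s).

End Regularity.

Definition zariski_open (K : fieldType) (n : nat) (V : ('I_n -> K) -> Prop) :
    Prop :=
  exists E : {mpoly K[n]} -> Prop,
    forall lam, V lam <-> exists2 p, E p & p.@[lam] != 0.

Definition flam (K : fieldType) (n : nat) (lam : 'I_n -> K) : polyxy K n :=
  \sum_(i < n) (lam i)%:MP%:MP * varx K i * vary K i.

(* Main.v *)
Require Import Defs.
From HB Require Import structures.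
From mathcomp Require Import all_boot all_order all_algebra.
From mathcomp Require Import mpoly.
From mathcomp Require Import boolp zify ring.

Set Implicit Arguments.
Unset Strict Implicit.
Unset Printing Implicit Defensive.

Import GRing.Theory Num.Theory.

Local Open Scope ring_scope.

Local Notation frac := Defs.frac.
Local Notation span := Defs.span.

(** Top local cohomology is right exact, so that [H^n(P / f^r)] is the cokernel
    of [f^r] on [H^n(P)], which is free over [P_0] on the monomials
    [y^(- m - 1)]. Writing [u^m / m!] for [y^(- m - 1)] turns multiplication by
    [y_i] into differentiation by [u_i], hence multiplication by [f] into the
    polarization operator [E = sum_i lam_i x_i d/du_i] on [K[x, u]]. For
    [j = - n - d] the module to study is therefore [N = A_d / E^r A_(d + r)],
    where [A_d] is the part of [K[x, u]] of degree [d] in [u], see [top_gen_rel].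

    When no [lam_i] vanishes, [E] and [F = sum_i lam_i^-1 u_i d/dx_i] generate
    an action of sl2 for which bidegree [(a, b)] has weight [a - b]
    ([polar_sl2]). In characteristic zero, [E^r] is onto in the weights at least
    [r] ([sl2_surj]), so that [N] vanishes in degrees greater than
    [s = d + r - 1]. On the other hand a highest weight vector of weight [r - 1]
    is not in the image of [E^r] ([sl2_not_image]), because [E^(r + 1)] is
    injective on the opposite weight; with at least two variables there is
    such a vector of bidegree [(s, d)] ([polar_highest]). Hence [N] has finite
    length, and [s] is its largest degree.

    The regularity of such a module is [s] ([has_reg_finite_length]). A minimal
    resolution is built by taking syzygies of minimal generators, and it is
    controlled by the Koszul homology of the successive modules of syzygies. As
    the Koszul complex of a free module is acyclic, passing from a module to its
    syzygies lowers the homological degree by one ([koszul_exact_syzygies]).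
    For the relations of [N] the homology in homological degree [p] vanishes in
    internal degrees greater than [s + 1 + p], since [N] vanishes beyond [s];
    hence every module of syzygies is finitely generated, in degrees at most
    [s + i] for the [i]-th module of the resolution. A nonzero element of degree
    [s] of [N] is killed by the variables, and so gives a nonzero class in the
    highest homological degree ([koszul_socle]), that is, a generator of degree
    [s + n] in the [n]-th module: the bound is attained. *)

(** * Polynomials given by their coefficients *)

Section CoefficientwisePolynomials.
Variables (R : nzRingType) (n : nat).
Implicit Types (p q : {mpoly R[n]}) (m : 'X_{1..n}).

Definition mpoly_of_coef (k : nat) (c : 'X_{1..n} -> R) : {mpoly R[n]} :=
  \sum_(m : 'X_{1..n < k}) c m *: 'X_[m].

Lemma mcoeff_of_coef k (c : 'X_{1..n} -> R) m :
  (forall m', (k <= mdeg m')%N -> c m' = 0) -> (mpoly_of_coef k c)@_m = c m.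
Proof.
move=> c0; have [lt_mk|le_km] := ltnP (mdeg m) k.
  by rewrite /mpoly_of_coef mcoeff_mpoly.
rewrite c0 // raddf_sum big1 //= => m' _; rewrite mcoeffZ mcoeffX.
case: eqP => [eq_m|_]; last by rewrite mulr0.
by have := bmdeg m'; rewrite eq_m ltnNge le_km.
Qed.

Lemma mcoeff_msize p m : (msize p <= mdeg m)%N -> p@_m = 0.
Proof. by move=> le_pm; apply/eqP; rewrite mcoeff_eq0 msize_mdeg_ge. Qed.

Lemma mcoeff_XM i p m :
  ('X_i * p)@_m = if (m i == 0)%N then 0 else p@_(m - U_(i))%MM.
Proof.
have -> : 'X_i * p = p * 'X_i by rewrite [RHS]commr_mpolyX.
case: eqP => [mi0|/eqP mi_n0].
  apply/eqP; rewrite mcoeff_eq0 (perm_mem (msuppMX _ _)); apply/negP => /mapP[m' _ eq_m].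
  by move: mi0; rewrite eq_m mnmDE mnm1E eqxx.
have le_im : (U_(i) <= m)%MM.
  by apply/mnm_lepP => j; rewrite mnm1E; case: eqP => // <-; rewrite lt0n.
by rewrite -[in LHS](submK le_im) addmC mcoeffMX.
Qed.

Definition mhomog_comp (e : int) p : {mpoly R[n]} :=
  mpoly_of_coef (msize p) (fun m => if (mdeg m)%:Z == e then p@_m else 0).

Lemma mcoeff_homog_comp e p m :
  (mhomog_comp e p)@_m = if (mdeg m)%:Z == e then p@_m else 0.
Proof.
by rewrite mcoeff_of_coef // => m' /mcoeff_msize ->; rewrite if_same.
Qed.

Definition set_var0 (i : 'I_n) p : {mpoly R[n]} :=
  mpoly_of_coef (msize p) (fun m => if m i == 0%N then p@_m else 0).

Lemma mcoeff_set_var0 i p m :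
  (set_var0 i p)@_m = if m i == 0%N then p@_m else 0.
Proof.
by rewrite mcoeff_of_coef // => m' /mcoeff_msize ->; rewrite if_same.
Qed.

Definition div_var (i : 'I_n) p : {mpoly R[n]} :=
  mpoly_of_coef (msize p) (fun m => p@_(m + U_(i))).

Lemma mcoeff_div_var i p m : (div_var i p)@_m = p@_(m + U_(i)).
Proof.
rewrite mcoeff_of_coef // => m' le_pm; apply: mcoeff_msize.
by rewrite mdegD (leq_trans le_pm) ?leq_addr.
Qed.

Lemma mhomog_compD e p q : mhomog_comp e (p + q) = mhomog_comp e p + mhomog_comp e q.
Proof.
by apply/mpolyP => m; rewrite mcoeffD !mcoeff_homog_comp mcoeffD; case: ifP; rewrite ?addr0.
Qed.

Lemma div_varXK i p : div_var i ('X_i * p) = p.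
Proof.
apply/mpolyP => m; rewrite mcoeff_div_var mcoeff_XM mnmDE mnm1E eqxx addn1 /=.
by rewrite addmK.
Qed.

Lemma set_var0X i p : set_var0 i ('X_i * p) = 0.
Proof.
by apply/mpolyP => m; rewrite mcoeff_set_var0 mcoeff_XM mcoeff0; case: eqP.
Qed.

Lemma set_var0_div i p : set_var0 i p + 'X_i * div_var i p = p.
Proof.
apply/mpolyP => m; rewrite mcoeffD mcoeff_set_var0 mcoeff_XM mcoeff_div_var.
case: eqP => [_|/eqP mi_n0]; rewrite ?addr0 ?add0r // submK //.
by apply/mnm_lepP => j; rewrite mnm1E; case: eqP => // <-; rewrite lt0n.
Qed.

Lemma div_varXC i j p : i != j -> div_var i ('X_j * p) = 'X_j * div_var i p.
Proof.
move=> ne_ij; apply/mpolyP => m; rewrite mcoeff_div_var !mcoeff_XM mcoeff_div_var.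
rewrite mnmDE mnm1E (negPf ne_ij) addn0; case: eqP => // mj_n0.
congr (_@_ _); apply/mnmP => k; rewrite !(mnmDE, mnmBE, mnm1E).
case: (eqVneq j k) => [<-|_]; last by rewrite !subn0.
by rewrite (negPf ne_ij) !addn0.
Qed.

Lemma set_var0XC i j p : i != j -> set_var0 i ('X_j * p) = 'X_j * set_var0 i p.
Proof.
move=> ne_ij; apply/mpolyP => m.
rewrite mcoeff_set_var0 !mcoeff_XM mcoeff_set_var0 mnmBE mnm1E.
have -> : (j == i) = false by rewrite eq_sym; apply: negPf.
by rewrite subn0; do 2 case: ifP.
Qed.

End CoefficientwisePolynomials.

(** * The Koszul complex *)

Section Koszul.
Variables (R : comNzRingType) (n : nat).
Local Notation S := {mpoly R[n]}.
Implicit Types (V W : lmodType S) (s : seq 'I_n).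

(** The Koszul complex of [V] on the variables with indices in [s], as an iterated
    mapping cone: the second component of a pair is the multiple of the exterior
    generator of the head of [s], so that an entry reached by choosing the
    second component [p] times sits in homological degree [p]. *)
Fixpoint koszul V s : lmodType S :=
  if s is _ :: s' then (koszul V s' * koszul V s')%type else V.

Fixpoint koszul_diff V s : koszul V s -> koszul V s :=
  match s return koszul V s -> koszul V s with
  | [::] => fun=> 0
  | i :: s' => fun w =>
      (koszul_diff w.1 + 'X_i *: w.2, - koszul_diff w.2)
  end.

Fixpoint koszul_map V W (f : V -> W) s : koszul V s -> koszul W s :=
  match s return koszul V s -> koszul W s with
  | [::] => f
  | i :: s' => fun w => (koszul_map f w.1, koszul_map f w.2)
  end.

(** In [koszul_all Q w] the predicate [Q p] is imposed on the entries of [w] of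
    homological degree [p]. *)
Fixpoint koszul_all V (Q : nat -> V -> Prop) s : koszul V s -> Prop :=
  match s return koszul V s -> Prop with
  | [::] => Q 0%N
  | i :: s' => fun w =>
      koszul_all Q w.1 /\ koszul_all (fun p => Q p.+1) w.2
  end.

Fixpoint koszul_in0 V s : V -> koszul V s :=
  match s return V -> koszul V s with
  | [::] => id
  | i :: s' => fun v => (koszul_in0 s' v, 0)
  end.

Fixpoint koszul_out0 V s : koszul V s -> V :=
  match s return koszul V s -> V with
  | [::] => id
  | i :: s' => fun w => koszul_out0 w.1
  end.

Section Basics.
Variables (V : lmodType S).

Lemma koszul_diffD s : {morph @koszul_diff V s : u v / u + v}.
Proof.
elim: s => [|i s IHs] u v /=; first by rewrite addr0.
by rewrite !IHs scalerDr opprD addrACA.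
Qed.

Lemma koszul_diff0 s : @koszul_diff V s 0 = 0.
Proof. by apply: (addrI (@koszul_diff V s 0)); rewrite -koszul_diffD !addr0. Qed.

Lemma koszul_diffN s : {morph @koszul_diff V s : u / - u}.
Proof.
by move=> u; apply: (addrI (@koszul_diff V s u)); rewrite -koszul_diffD !subrr koszul_diff0.
Qed.

Lemma koszul_diffB s : {morph @koszul_diff V s : u v / u - v}.
Proof. by move=> u v; rewrite koszul_diffD koszul_diffN. Qed.

Lemma koszul_diffZ s c : {morph @koszul_diff V s : u / c *: u}.
Proof.
elim: s => [|i s IHs] u /=; first by rewrite scaler0.
by rewrite !IHs; congr (_, _); rewrite ?scalerDr ?scalerN // !scalerA mulrC.
Qed.

Lemma koszul_diffK s (w : koszul V s) : koszul_diff (koszul_diff w) = 0.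
Proof.
elim: s w => [|i s IHs] w //=.
by rewrite koszul_diffD koszul_diffZ koszul_diffN !IHs scalerN add0r addrN !oppr0.
Qed.

Lemma koszul_diff_in0 s (v : V) : koszul_diff (koszul_in0 s v) = 0.
Proof.
by elim: s => //= i s ->; rewrite scaler0 addr0 koszul_diff0 oppr0.
Qed.

Lemma koszul_in0K s : cancel (@koszul_in0 V s) (@koszul_out0 V s).
Proof. by elim: s. Qed.

End Basics.

Section Predicates.
Variables (V : lmodType S).
Implicit Types (Q : nat -> V -> Prop).

Lemma koszul_all_sub Q Q' s (w : koszul V s) :
  (forall p v, Q p v -> Q' p v) -> koszul_all Q w -> koszul_all Q' w.
Proof.
elim: s Q Q' w => [|i s IHs] Q Q' w QQ' /=; first exact: QQ'.
move=> [Q1 Q2]; split; first exact: (IHs Q).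
by apply: IHs Q2 => p; apply: QQ'.
Qed.

Lemma koszul_all0 Q s : (forall p, Q p 0) -> @koszul_all V Q s 0.
Proof. by elim: s Q => [|i s IHs] Q Q0 //=; split; apply: IHs. Qed.

Lemma koszul_allD Q s (w w' : koszul V s) :
  (forall p u v, Q p u -> Q p v -> Q p (u + v)) ->
  koszul_all Q w -> koszul_all Q w' -> koszul_all Q (w + w').
Proof.
elim: s Q w w' => [|i s IHs] Q w w' QD /=; first exact: QD.
by move=> [Q1 Q2] [Q1' Q2']; split; apply: IHs => // p; apply: QD.
Qed.

Lemma koszul_allZ Q Q' s (w : koszul V s) c :
  (forall p u, Q p u -> Q' p (c *: u)) -> koszul_all Q w -> koszul_all Q' (c *: w).
Proof.
elim: s Q Q' w => [|i s IHs] Q Q' w QZ /=; first exact: QZ.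
by move=> [Q1 Q2]; split; [apply: IHs Q1|apply: IHs Q2] => p; apply: QZ.
Qed.

Lemma koszul_all_diff Q Q' s (w : koszul V s) :
    (forall p, Q' p 0) -> (forall p u v, Q' p u -> Q' p v -> Q' p (u + v)) ->
    (forall p c u, Q' p u -> Q' p (c%:MP *: u)) ->
    (forall i p v, Q p.+1 v -> Q' p ('X_i *: v)) ->
  koszul_all Q w -> koszul_all Q' (koszul_diff w).
Proof.
elim: s Q Q' w => [|i s IHs] Q Q' w Q'0 Q'D Q'Z QQ' /=; first by [].

move=> [Q1 Q2]; split.
  apply: koszul_allD => //; first exact: IHs Q1.
  by apply: koszul_allZ Q2 => p u; apply: QQ'.
rewrite -scaleN1r -mpolyC1 -mpolyCN; apply: (@koszul_allZ (fun p => Q' p.+1)) => [p u|].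
  exact: Q'Z.
by apply: IHs Q2 => // p; [apply: Q'D|apply: Q'Z|move=> *; apply: QQ'].
Qed.

Lemma koszul_all_in0 Q s (v : V) :
  Q 0%N v -> (forall p, Q p.+1 0) -> koszul_all Q (koszul_in0 s v).
Proof.
move=> Qv Q0; elim: s => //= i s IHs; split=> //.
exact: koszul_all0.
Qed.

Lemma koszul_all_out0 Q s (w : koszul V s) : koszul_all Q w -> Q 0%N (koszul_out0 w).
Proof. by elim: s w => //= i s IHs w [/IHs]. Qed.

Lemma koszul_in0_out0 Q s (w : koszul V s) :
  (forall p v, Q p.+1 v -> v = 0) -> koszul_all Q w ->
  w = koszul_in0 s (koszul_out0 w).
Proof.
move=> Q0; elim: s w => //= i s IHs [a b] /= [/IHs Q1 Q2]; congr (_, _) => //.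
elim: s b Q Q0 Q2 {a IHs Q1} => [|j s IHs] b Q Q0 /=; first exact: Q0.
move=> [b1 b2]; case: b b1 b2 => b1 b2 /= Q1 Q2; congr (_, _).
  exact: (IHs _ Q).
by apply: (IHs _ (fun p => Q p.+1)) Q2 => p; apply: Q0.
Qed.

(** The degree zero part of a boundary is a combination of products of
    variables with degree one entries: Koszul homology in degree zero is the
    quotient by the ideal of the variables. *)
Lemma koszul_out0_diff Q (P : V -> Prop) s (w : koszul V s) :
    P 0 -> (forall u v, P u -> P v -> P (u + v)) ->
    (forall i v, Q 1%N v -> P ('X_i *: v)) ->
  koszul_all Q w -> P (koszul_out0 (koszul_diff w)).
Proof.
move=> P0 PD QP; elim: s w => //= i s IHs w [Q1 Q2].
have -> : koszul_out0 (koszul_diff w.1 + 'X_i *: w.2) =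
    koszul_out0 (koszul_diff w.1) + 'X_i *: koszul_out0 w.2.
  elim: (s) (koszul_diff w.1) (w.2) => [|j s' IH] u v //=.
by apply: PD; [apply: IHs|apply: QP; apply: koszul_all_out0 Q2].
Qed.

End Predicates.

Section Maps.
Variables (V W : lmodType S) (f : {additive V -> W}).

Lemma koszul_mapD s : {morph koszul_map f (s := s) : u v / u + v}.
Proof. by elim: s => [|i s IHs] u v /=; rewrite ?raddfD // !IHs. Qed.

Lemma koszul_map0 s : @koszul_map V W f s 0 = 0.
Proof. by apply: (addrI (@koszul_map _ _ f s 0)); rewrite -koszul_mapD !addr0. Qed.

Lemma koszul_mapN s : {morph koszul_map f (s := s) : u / - u}.
Proof.
by move=> u; apply: (addrI (koszul_map f u)); rewrite -koszul_mapD !subrr koszul_map0.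
Qed.

Lemma koszul_mapB s : {morph koszul_map f (s := s) : u v / u - v}.
Proof. by move=> u v; rewrite koszul_mapD koszul_mapN. Qed.

Lemma koszul_map_scale s (c c' : S) (w : koszul V s) :
  (forall v, f (c *: v) = c' *: f v) -> koszul_map f (c *: w) = c' *: koszul_map f w.
Proof. by move=> fZ; elim: s w => [|i s IHs] w /=; rewrite ?fZ // !IHs. Qed.

Lemma koszul_map_diff s (w : koszul V s) :
  (forall i v, i \in s -> f ('X_i *: v) = 'X_i *: f v) ->
  koszul_map f (koszul_diff w) = koszul_diff (koszul_map f w).
Proof.
elim: s w => [|i s IHs] w fX /=; first by rewrite raddf0.
have fXs j v : j \in s -> f ('X_j *: v) = 'X_j *: f v.
  by move=> s_j; apply: fX; rewrite inE s_j orbT.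
rewrite koszul_mapD koszul_mapN !IHs // (@koszul_map_scale _ _ 'X_i) // => v.
by apply: fX; rewrite inE eqxx.
Qed.

Lemma koszul_all_map (Q : nat -> V -> Prop) (Q' : nat -> W -> Prop) s (w : koszul V s) :
  (forall p v, Q p v -> Q' p (f v)) -> koszul_all Q w -> koszul_all Q' (koszul_map f w).
Proof.
elim: s Q Q' w => [|i s IHs] Q Q' w QQ' /=; first exact: QQ'.
by move=> [Q1 Q2]; split; [apply: IHs Q1|apply: IHs Q2] => p; apply: QQ'.
Qed.

Lemma koszul_all_lift (Q : nat -> V -> Prop) (Q' : nat -> W -> Prop) s (w : koszul W s) :
  (forall p v, Q' p v -> exists2 u, Q p u & f u = v) -> koszul_all Q' w ->
  exists2 u, koszul_all Q u & koszul_map f u = w.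
Proof.
elim: s Q Q' w => [|i s IHs] Q Q' w QQ' /=; first exact: QQ'.
move=> [/(IHs Q)[//|u1 Qu1 fu1]].
case/(IHs (fun p => Q p.+1)) => [p|u2 Qu2 fu2]; first exact: QQ'.
by exists (u1, u2); rewrite //= fu1 fu2; case: (w).
Qed.

Lemma koszul_all_ker (Q : nat -> V -> Prop) s (w : koszul V s) :
  koszul_all Q w -> koszul_map f w = 0 ->
  koszul_all (fun p v => Q p v /\ f v = 0) w.
Proof.
elim: s Q w => [|i s IHs] Q w //= [Q1 Q2] [fw1 fw2].
by split; [apply: IHs|apply: (IHs (fun p => Q p.+1))].
Qed.

Lemma koszul_map_out0 s (w : koszul V s) :
  koszul_out0 (koszul_map f w) = f (koszul_out0 w).
Proof. by elim: s w => //= i s IHs w; rewrite IHs. Qed.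

Lemma koszul_map_eq0 s (w : koszul V s) :
  koszul_all (fun=> fun v => f v = 0) w -> koszul_map f w = 0.
Proof.
elim: s w => //= i s IHs w [w1 w2].
by rewrite IHs // IHs.
Qed.

End Maps.

(** ** Acyclicity over free modules *)

Section Homotopy.
Variable b : nat.
Local Notation V := ('rV[S]_b).

Fact set_var0_additive i : zmod_morphism (@set_var0 R n i).
Proof.
move=> p q; apply/mpolyP => m; rewrite mcoeffB !mcoeff_set_var0 mcoeffB.
by case: ifP; rewrite ?subr0.
Qed.
HB.instance Definition _ i :=
  GRing.isZmodMorphism.Build S S (set_var0 i) (set_var0_additive i).

Fact div_var_additive i : zmod_morphism (@div_var R n i).
Proof. by move=> p q; apply/mpolyP => m; rewrite mcoeffB !mcoeff_div_var mcoeffB. Qed.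
HB.instance Definition _ i :=
  GRing.isZmodMorphism.Build S S (div_var i) (div_var_additive i).

Local Notation e i := (map_mx (@set_var0 R n i) : V -> V).
Local Notation d i := (map_mx (@div_var R n i) : V -> V).

(** The tensor product of the contractions of the one-variable complexes: [d i]
    divides the monomials by [X_i], after [e j] has set to zero the variables
    already treated. *)
Fixpoint koszul_htpy s : koszul V s -> koszul V s :=
  match s return koszul V s -> koszul V s with
  | [::] => fun=> 0
  | i :: s' => fun w =>
      (koszul_htpy (koszul_map (e i) w.1), koszul_map (d i) w.1)
  end.

Fixpoint koszul_aug s : koszul V s -> koszul V s :=
  match s return koszul V s -> koszul V s with
  | [::] => id
  | i :: s' => fun w => (koszul_aug (koszul_map (e i) w.1), 0)
  end.

(** By induction on the variables: over one variable the identity is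
    [p = p|_(X_i = 0) + X_i * div_var i p], and both operators on the right
    commute with the other variables. *)
Lemma koszul_htpyP s (w : koszul V s) : uniq s ->
  koszul_diff (koszul_htpy w) + koszul_htpy (koszul_diff w) = w - koszul_aug w.
Proof.
elim: s w => [|i s IHs] [] //=; first by move=> *; rewrite addr0 subrr.
move=> a b' /andP[s'i us].
have ne_ij j : j \in s -> i != j by apply: contraTneq => <-.
have Xe : koszul_map (e i) ('X_i *: b') = 0.
  rewrite (koszul_map_scale (c' := 0)) ?scale0r // => v; rewrite scale0r.
  by apply/rowP => k; rewrite !mxE /= set_var0X.
have Xd : koszul_map (d i) ('X_i *: b') = b'.
  elim: (s) b' {Xe} => [|j s' IH] c /=; last by rewrite !IH; case: c.
  by apply/rowP => k; rewrite !mxE /= div_varXK.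
have eK : koszul_map (e i) a + 'X_i *: koszul_map (d i) a = a.
  elim: (s) (a) => [|j s' IH] c /=; first by apply/rowP => k; rewrite !mxE /= set_var0_div.
  by case: c => c1 c2 /=; congr (_, _); apply: IH.
congr (_, _) => /=.
  rewrite koszul_mapD Xe addr0 koszul_map_diff => [|j v s_j]; last first.
    by apply/rowP => k; rewrite !mxE /= set_var0XC ?ne_ij.
  by rewrite addrAC IHs // addrAC; congr (_ - _); apply: eK.
rewrite koszul_mapD Xd koszul_map_diff => [|j v s_j]; last first.
  by apply/rowP => k; rewrite !mxE /= div_varXC ?ne_ij.
by rewrite addKr oppr0 addr0.
Qed.

Lemma koszul_htpy0 s : @koszul_htpy s 0 = 0.
Proof.
by elim: s => //= i s IHs; rewrite !koszul_map0 IHs.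
Qed.

Lemma koszul_all_htpy (Q Q' : nat -> V -> Prop) s (w : koszul V s) :
    Q' 0%N 0 -> (forall i p v, Q p v -> Q p (e i v)) ->
    (forall i p v, Q p v -> Q' p.+1 (d i v)) ->
  koszul_all Q w -> koszul_all Q' (koszul_htpy w).
Proof.
move=> Q'0 Qe Qd; elim: s w => [|i s IHs] w //= [Q1 _]; split.
  by apply: IHs; apply: koszul_all_map Q1 => p v; apply: Qe.
by apply: koszul_all_map Q1 => p v; apply: Qd.
Qed.

Lemma koszul_aug_eq0 s (w : koszul V s) :
  (forall k (m : 'X_{1..n}), (forall i, i \in s -> m i = 0%N) -> (koszul_out0 w 0 k)@_m = 0) ->
  koszul_aug w = 0.
Proof.
elim: s w => [|i s IHs] w /= w0.
  by apply/rowP => k; apply/mpolyP => m; rewrite w0 // mxE mcoeff0.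
congr (_, _); apply: IHs => k m m0; rewrite koszul_map_out0 mxE /= mcoeff_set_var0.
by case: eqP => // mi0; apply: w0 => j; rewrite inE => /predU1P[->|/m0].
Qed.

End Homotopy.

End Koszul.

(** * Graded submodules of free modules *)

Section GradedVectors.
Variables (K : fieldType) (n : nat).
Local Notation S := {mpoly K[n]}.

Lemma xhomogP d (p : S) : xhomog d p <-> forall m, p@_m != 0 -> (mdeg m)%:Z = d.
Proof. by split=> h m; have := h m; rewrite mcoeff_msupp. Qed.

Lemma xhomog0 d : xhomog d (0 : S).
Proof. by apply/xhomogP => m; rewrite mcoeff0 eqxx. Qed.

Lemma xhomogD d (p q : S) : xhomog d p -> xhomog d q -> xhomog d (p + q).
Proof. by move=> hp hq m /msuppD_le; rewrite mem_cat => /orP[/hp|/hq]. Qed.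

Lemma xhomogM d e (p q : S) : xhomog d p -> xhomog e q -> xhomog (d + e) (p * q).
Proof.
by move=> hp hq m /msuppM_le/allpairsP[[m1 m2] /= [/hp <- /hq <- ->]]; rewrite mdegD.
Qed.

Lemma xhomogX i : xhomog 1 ('X_i : S).
Proof. by move=> m; rewrite msuppX inE => /eqP ->; rewrite mdeg1. Qed.

Lemma xhomog_comp e (p : S) : xhomog e (mhomog_comp e p).
Proof.
by apply/xhomogP => m; rewrite mcoeff_homog_comp; case: (_ =P e) => // _; rewrite eqxx.
Qed.

Lemma mhomog_comp_id e (p : S) : xhomog e p -> mhomog_comp e p = p.
Proof.
move/xhomogP=> hp; apply/mpolyP => m; rewrite mcoeff_homog_comp.
case: (_ =P e) => // ne_me; apply/esym/eqP; apply: contra_notT ne_me; exact: hp.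
Qed.

Lemma mhomog_compMr d e (p q : S) :
  xhomog d q -> mhomog_comp e (p * q) = mhomog_comp (e - d) p * q.
Proof.
move/xhomogP=> hq; apply/mpolyP => m; rewrite mcoeff_homog_comp !mcoeffM.
rewrite [in RHS](eq_bigr (fun k : 'X_{1..n < _, _} => if (mdeg m)%:Z == e
    then p@_(k.1)%PAIR * q@_(k.2)%PAIR else 0)); first by case: ifP; rewrite // big1.
move=> k /eqP eq_m; rewrite mcoeff_homog_comp.
have [->|/hq hk2] := eqVneq q@_(k.2)%PAIR 0; first by rewrite !mulr0 if_same.
suff -> : ((mdeg k.1)%:Z == e - d) = ((mdeg m)%:Z == e).
  by case: ifP; rewrite ?mul0r.
have {eq_m} := congr1 (@mdeg n) eq_m; rewrite mdegD; lia.
Qed.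

Lemma mhomog_comp0 e : mhomog_comp e 0 = 0 :> S.
Proof. exact: mhomog_comp_id (xhomog0 e). Qed.

Lemma mhomog_comp_sum e I (s : seq I) (P : pred I) (F : I -> S) :
  mhomog_comp e (\sum_(i <- s | P i) F i) = \sum_(i <- s | P i) mhomog_comp e (F i).
Proof. exact: (big_morph _ (@mhomog_compD _ _ e) (mhomog_comp0 e)). Qed.

Lemma xhomog_coef0 d (p : S) : xhomog d p -> d != 0 -> p@_0%MM = 0.
Proof.
move/xhomogP => hp; apply: contraNeq => /hp <-; by rewrite mdeg0.
Qed.

Lemma xhomog0_const (p : S) : xhomog 0 p -> p = (p@_0%MM)%:MP.
Proof.
move/xhomogP => hp; apply/mpolyP => m; rewrite mcoeffC.
have [->|m_n0] := eqVneq m 0%MM; first by rewrite mulr1.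
rewrite mulr0; apply/eqP; apply: contraNT m_n0 => /hp /eqP.
by rewrite eqz_nat mdeg_eq0.
Qed.

Section Vectors.
Variables (b : nat) (dg : 'I_b -> int).
Implicit Types (u v : 'rV[S]_b).

Definition vhomog a v := forall k, xhomog (a - dg k) (v 0 k).

Definition vcomp a v : 'rV[S]_b := \row_k mhomog_comp (a - dg k) (v 0 k).

Lemma vhomog_comp a v : vhomog a (vcomp a v).
Proof. by move=> k; rewrite mxE; apply: xhomog_comp. Qed.

Lemma vcomp_id a v : vhomog a v -> vcomp a v = v.
Proof. by move=> hv; apply/rowP => k; rewrite mxE mhomog_comp_id. Qed.

Lemma vhomog0 a : vhomog a 0.
Proof. by move=> k; rewrite mxE; apply: xhomog0. Qed.

Lemma vhomogD a u v : vhomog a u -> vhomog a v -> vhomog a (u + v).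
Proof. by move=> hu hv k; rewrite mxE; apply: xhomogD. Qed.

Lemma vhomogZ a d c v : xhomog d c -> vhomog a v -> vhomog (d + a) (c *: v).
Proof. by move=> hc hv k; rewrite mxE -addrA; apply: xhomogM. Qed.

Lemma vcomp_sum v : exists s : seq int, v = \sum_(a <- s) vcomp a v.
Proof.
exists (undup (flatten [seq [seq (mdeg m)%:Z + dg k | m <- msupp (v 0 k)] |
          k <- enum 'I_b])).
apply/rowP => k; apply/mpolyP => m; rewrite summxE raddf_sum /=.
under eq_bigr => a _ do rewrite mxE mcoeff_homog_comp.
have [v0|/negP v_n0] := boolP ((v 0 k)@_m == 0).
  by rewrite (eqP v0) big1 // => a _; rewrite if_same.
rewrite (bigD1_seq ((mdeg m)%:Z + dg k)) ?undup_uniq //=; last first.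
  rewrite mem_undup; apply/flattenP.
  exists [seq (mdeg m)%:Z + dg k | m <- msupp (v 0 k)].
    by apply: map_f; rewrite mem_enum.
  by apply: (map_f (fun m => (mdeg m)%:Z + dg k)); rewrite mcoeff_msupp; apply/negP.
rewrite addrK eqxx big1 ?addr0 // => a ne_a.
by rewrite -subr_eq0 opprB addrA subr_eq0 eq_sym (negPf ne_a).
Qed.

Lemma vhomog_bounded_below :
  exists a0 : int, forall (a : int) v, a < a0 -> vhomog a v -> v = 0.
Proof.
(* a nonzero entry in column [k] forces [dg k <= a] *)
exists (- \sum_k `|dg k|) => a v lt_a hv; apply/rowP => k; rewrite mxE.
apply/mpolyP => m; rewrite mcoeff0; apply/eqP; apply/negPn/negP.
have /xhomogP := hv k; move=> /[apply].
have : `|dg k| <= \sum_k `|dg k|.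
  by rewrite (bigD1 k) //= lerDl; apply: sumr_ge0.
by lia.
Qed.

Record graded_submod (M : 'rV[S]_b -> Prop) : Prop := GradedSubmod {
  gsub0 : M 0;
  gsubD : forall u v, M u -> M v -> M (u + v);
  gsubZ : forall c v, M v -> M (c *: v);
  gsub_comp : forall a v, M v -> M (vcomp a v) }.

(** The entries of a chain of homological degree [p] and total degree [a]: those
    in other homological degrees vanish, and each exterior generator has internal
    degree one. *)
Definition koszul_deg (M : 'rV[S]_b -> Prop) p a (q : nat) v :=
  if q == p then vhomog (a - p%:Z) v /\ M v else v = 0.

Definition koszul_exact M p a :=
  forall w : koszul 'rV[S]_b (enum 'I_n),
    koszul_all (koszul_deg M p a) w -> koszul_diff w = 0 ->
  exists2 v, koszul_all (koszul_deg M p.+1 a) v & koszul_diff v = w.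

Lemma koszul_deg_sub (M M' : 'rV[S]_b -> Prop) p a q v :
  (forall v, vhomog (a - p%:Z) v -> M v -> M' v) ->
  koszul_deg M p a q v -> koszul_deg M' p a q v.
Proof. by rewrite /koszul_deg; case: eqP => // _ MM' [hv /(MM' _ hv)]. Qed.

Section Closure.
Variables (M : 'rV[S]_b -> Prop) (gM : graded_submod M).

Lemma koszul_deg0 p a q : koszul_deg M p a q 0.
Proof.
by rewrite /koszul_deg; case: eqP => // _; split; [apply: vhomog0|apply: gsub0].
Qed.

Lemma koszul_degD p a q u v :
  koszul_deg M p a q u -> koszul_deg M p a q v -> koszul_deg M p a q (u + v).
Proof.
rewrite /koszul_deg; case: eqP => _; last by move=> -> ->; rewrite addr0.
by move=> [hu Mu] [hv Mv]; split; [apply: vhomogD|apply: gsubD].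
Qed.

Lemma koszul_degZ p a q c v :
  koszul_deg M p a q v -> koszul_deg M p a q (c%:MP *: v).
Proof.
rewrite /koszul_deg; case: eqP => _; last by move=> ->; rewrite scaler0.
move=> [hv Mv]; split; last exact: gsubZ.
rewrite -[_ - _]add0r; apply: vhomogZ => //.
by move=> m; rewrite msuppC; case: ifP => // _; rewrite inE => /eqP ->; rewrite mdeg0.
Qed.

Lemma koszul_degX p a q i v :
  koszul_deg M p.+1 a q.+1 v -> koszul_deg M p a q ('X_i *: v).
Proof.
rewrite /koszul_deg eqSS; case: eqP => _; last by move=> ->; rewrite scaler0.
move=> [hv Mv]; split; last exact: gsubZ.
have -> : a - p%:Z = 1 + (a - p.+1%:Z) by lia.
by apply: vhomogZ => //; apply: xhomogX.
Qed.

Lemma koszul_deg_diff p a s (w : koszul 'rV[S]_b s) :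
  koszul_all (koszul_deg M p.+1 a) w -> koszul_all (koszul_deg M p a) (koszul_diff w).
Proof.
apply: koszul_all_diff; [apply: koszul_deg0|apply: koszul_degD|apply: koszul_degZ|].
by move=> i q v; apply: (koszul_degX i).
Qed.

Lemma koszul_deg_out0 a s (w : koszul 'rV[S]_b s) :
  koszul_all (koszul_deg M 0 a) w -> w = koszul_in0 s (koszul_out0 w).
Proof. by apply: koszul_in0_out0 => p v. Qed.

Lemma koszul_deg_in0 a s v : vhomog a v -> M v ->
  koszul_all (koszul_deg M 0 a) (koszul_in0 s v).
Proof.
move=> hv Mv; apply: koszul_all_in0 => [|p]; last exact: koszul_deg0.
by rewrite /koszul_deg /= subr0.
Qed.

(** Graded Nakayama: exactness in homological degree zero says that the
    elements of degree [a] are combinations of elements of degree [a - 1]. *)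
Lemma koszul_exact0_ind a (P : 'rV[S]_b -> Prop) :
    koszul_exact M 0 a ->
    P 0 -> (forall u v, P u -> P v -> P (u + v)) ->
    (forall i v, vhomog (a - 1) v -> M v -> P ('X_i *: v)) ->
  forall v, vhomog a v -> M v -> P v.
Proof.
move=> exM P0 PD PX v hv Mv.
have [w Qw dw] := exM _ (koszul_deg_in0 (enum 'I_n) hv Mv) (koszul_diff_in0 _ _).
rewrite -(koszul_in0K (enum 'I_n) v) -dw.
apply: (@koszul_out0_diff _ _ _ (koszul_deg M 1 a)) => // i u.
by rewrite /koszul_deg /= => -[]; apply: PX.
Qed.

End Closure.

(** The homotopy contracts the complex onto the constant terms of its entries of
    homological degree zero. *)
Lemma koszul_acyclic p a (w : koszul 'rV[S]_b (enum 'I_n)) :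
    koszul_all (koszul_deg (fun=> True) p a) w -> koszul_diff w = 0 ->
    (p = 0%N -> forall k, (koszul_out0 w 0 k)@_0%MM = 0) ->
  exists2 v, koszul_all (koszul_deg (fun=> True) p.+1 a) v & koszul_diff v = w.
Proof.
move=> Qw dw w0; exists (koszul_htpy w).
  apply: koszul_all_htpy Qw => [|i q v|i q v].
  - by rewrite /koszul_deg.
  - rewrite /koszul_deg; case: eqP => [_ [hv _]|_ ->]; last by rewrite raddf0.
    split=> // k; apply/xhomogP => m; rewrite mxE /= mcoeff_set_var0.
    by case: ifP => _; [have /xhomogP := hv k; apply|rewrite eqxx].
  - rewrite /koszul_deg eqSS; case: eqP => [_ [hv _]|_ ->]; last by rewrite raddf0.
    split=> // k; apply/xhomogP => m; rewrite mxE /= mcoeff_div_var.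
    by have /xhomogP := hv k; move=> /[apply]; rewrite mdegD mdeg1; lia.
have := koszul_htpyP w (enum_uniq _).
rewrite dw koszul_htpy0 addr0 koszul_aug_eq0 ?subr0 // => k m m0.
have -> : m = 0%MM by apply/mnmP => i; rewrite mnm0E m0 ?mem_enum.
have := koszul_all_out0 Qw; rewrite /koszul_deg.
by case: eqP => [/esym/w0 ->|_ ->] //; rewrite mxE mcoeff0.
Qed.

End Vectors.

End GradedVectors.

(** * Minimal generators and syzygies *)

Section Syzygies.
Variables (K : fieldType) (n : nat).
Local Notation S := {mpoly K[n]}.

Definition mx_homog b b' (dg : 'I_b -> int) (dg' : 'I_b' -> int)
    (G : 'M[S]_(b', b)) :=
  forall k l, xhomog (dg' k - dg l) (G k l).

Lemma vcomp_mulmx b b' (dg : 'I_b -> int) (dg' : 'I_b' -> int) G a u :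
  mx_homog dg dg' G -> vcomp dg a (u *m G) = vcomp dg' a u *m G.
Proof.
move=> hG; apply/rowP => l; rewrite !mxE mhomog_comp_sum.
apply: eq_bigr => k _; rewrite (mhomog_compMr _ _ (hG k l)) mxE.
by congr (mhomog_comp _ _ * _); lia.
Qed.

Lemma vhomog_mulmx b b' (dg : 'I_b -> int) (dg' : 'I_b' -> int) G a u :
  mx_homog dg dg' G -> vhomog dg' a u -> vhomog dg a (u *m G).
Proof. by move=> hG /vcomp_id <-; rewrite -(vcomp_mulmx _ _ hG); apply: vhomog_comp. Qed.

Section Step.
Variables (b b' : nat) (dg : 'I_b -> int) (dg' : 'I_b' -> int).
Variables (G : 'M[S]_(b', b)) (M : 'rV[S]_b -> Prop).
Hypothesis hG : mx_homog dg dg' G.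
Hypothesis sub_GM : forall u, M (u *m G).
Hypothesis gen_GM : forall a v, vhomog dg a v -> M v -> exists u, v = u *m G.
Hypothesis minG : forall u : 'rV[S]_b', u *m G = 0 -> forall k, (u 0 k)@_0%MM = 0.

Definition syzygies (u : 'rV[S]_b') := u *m G = 0.

Lemma graded_syzygies : graded_submod dg' syzygies.
Proof.
split=> [|u v|c v|a v]; rewrite /syzygies.
- by rewrite mul0mx.
- by rewrite mulmxDl => -> ->; rewrite addr0.
- by rewrite -scalemxAl => ->; rewrite scaler0.
- by rewrite -(vcomp_mulmx _ _ hG) => ->; apply: vcomp_id (vhomog0 _ _).
Qed.

Lemma gen_homog a v : vhomog dg a v -> M v -> exists2 u, vhomog dg' a u & u *m G = v.
Proof.
move=> hv /(gen_GM hv)[u def_v]; exists (vcomp dg' a u); first exact: vhomog_comp.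
by rewrite -(vcomp_mulmx _ _ hG) -def_v vcomp_id.
Qed.

Local Notation f := (mulmxr G : {additive 'rV[S]_b' -> 'rV[S]_b}).
Local Notation s := (enum 'I_n).

Let fX (w : koszul 'rV[S]_b' s) :
  koszul_map f (koszul_diff w) = koszul_diff (koszul_map f w).
Proof. by apply: koszul_map_diff => i v _ /=; rewrite scalemxAl. Qed.

Let map_deg p a (w : koszul 'rV[S]_b' s) :
  koszul_all (koszul_deg dg' (fun=> True) p a) w ->
  koszul_all (koszul_deg dg M p a) (koszul_map f w).
Proof.
apply: koszul_all_map => q v; rewrite /koszul_deg.
case: eqP => [_ [hv _]|_ ->] /=; last by rewrite mul0mx.
by split; [apply: vhomog_mulmx hv|apply: sub_GM].
Qed.

Let lift_deg p a (w : koszul 'rV[S]_b s) :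
  koszul_all (koszul_deg dg M p a) w ->
  exists2 u, koszul_all (koszul_deg dg' (fun=> True) p a) u & koszul_map f u = w.
Proof.
apply: koszul_all_lift => q v; rewrite /koszul_deg.
case: eqP => [_ [hv /(gen_homog hv)[u hu <-]]|_ ->]; first by exists u.
by exists 0; rewrite //= mul0mx.
Qed.

Let ker_deg p a (w : koszul 'rV[S]_b' s) :
  koszul_all (koszul_deg dg' (fun=> True) p a) w -> koszul_map f w = 0 ->
  koszul_all (koszul_deg dg' syzygies p a) w.
Proof.
move=> Qw /(koszul_all_ker Qw); apply: koszul_all_sub => q v.
by rewrite /koszul_deg; case: eqP => [_ [[hv _] fv]|_ []].
Qed.

Let deg_ker p a (w : koszul 'rV[S]_b' s) :
  koszul_all (koszul_deg dg' syzygies p a) w ->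
  koszul_all (koszul_deg dg' (fun=> True) p a) w /\ koszul_map f w = 0.
Proof.
move=> Qw; split.
  by apply: koszul_all_sub Qw => q v; apply: koszul_deg_sub.
apply: koszul_map_eq0; apply: koszul_all_sub Qw => q v; rewrite /koszul_deg /=.
by case: eqP => [_ []|_ ->] //; rewrite mul0mx.
Qed.

(** The connecting homomorphism: as the free module is acyclic and the
    generators are minimal, Koszul homology of the syzygies is that of the
    module, one degree higher. *)
Lemma koszul_exact_syzygies p a :
  koszul_exact dg M p.+1 a <-> koszul_exact dg' syzygies p a.
Proof.
split=> exM w Qw dw.
  have [Qw' fw] := deg_ker Qw.
  have [|u Qu du] := koszul_acyclic Qw' dw.
    move=> p0 k; apply: minG.
    have := koszul_all_out0 Qw; rewrite /koszul_deg p0 eqxx => -[_]; exact.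
  have [|v Qv dv] := exM _ (map_deg Qu).
    by rewrite -fX du.
  have [v' Qv' fv'] := lift_deg Qv.
  exists (u - koszul_diff v'); last by rewrite koszul_diffB koszul_diffK subr0.
  apply: ker_deg; last by rewrite koszul_mapB fX fv' dv subrr.
  apply: koszul_allD => // [q x y|]; first exact: koszul_degD.
  rewrite -scaleN1r -mpolyC1 -mpolyCN; apply: koszul_allZ.
    by move=> q x; apply: koszul_degZ.
  exact: koszul_deg_diff.
have [w' Qw' fw'] := lift_deg Qw.
have Qz : koszul_all (koszul_deg dg' syzygies p a) (koszul_diff w').
  by apply: ker_deg; [apply: koszul_deg_diff|rewrite fX fw'].
have [u Qu du] := exM _ Qz (koszul_diffK _).
have [Qu' fu] := deg_ker Qu.
have [||//|v Qv dv] := @koszul_acyclic _ _ _ dg' p.+1 a (w' - u).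
- apply: koszul_allD => // [q x y|]; first exact: koszul_degD.
  rewrite -scaleN1r -mpolyC1 -mpolyCN; apply: koszul_allZ Qu'.
  by move=> q x; apply: koszul_degZ.
- by rewrite koszul_diffB du subrr.
exists (koszul_map f v); first exact: map_deg.
by rewrite -fX dv koszul_mapB fu fw' subr0.
Qed.

(** A minimal generator in degree [a] is visible in Koszul homology: without
    one, the coefficients expressing an element of degree [a] through the
    generators have no constant term. *)
Lemma koszul_exact0_no_gen a : (forall k, dg' k != a) -> koszul_exact dg M 0 a.
Proof.
move=> no_a w Qw dw; have [w' Qw' fw'] := lift_deg Qw.
have [||v Qv dv] := koszul_acyclic Qw'.
- by rewrite (koszul_deg_out0 Qw') koszul_diff_in0.
- move=> _ k; apply: (@xhomog_coef0 _ _ (a - dg' k)); last first.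
    by rewrite subr_eq0 eq_sym.
  by have := koszul_all_out0 Qw'; rewrite /koszul_deg /= subr0 => -[].
by exists (koszul_map f v); [apply: map_deg|rewrite -fX dv].
Qed.

(** The converse: a generator of degree [a] in the ideal of the variables
    would give a syzygy with a unit entry. *)
Lemma koszul_exact0_gen a : graded_submod dg M -> koszul_exact dg M 0 a -> forall k, dg' k != a.
Proof.
move=> gM exM k; apply/eqP => dg'k.
have hd : vhomog dg' a (delta_mx 0 k : 'rV[S]_b').
  move=> l; rewrite mxE eqxx /=; case: eqP => [->|_]; last exact: xhomog0.
  rewrite -dg'k subrr => m; rewrite mcoeff_msupp mcoeff1.
  by case: (m =P 0%MM) => [->|_]; rewrite ?mdeg0 // eqxx.
have [||i v hv Mv|u' [u0 def_u]] := koszul_exact0_ind gM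
    (P := fun v => exists u : 'rV[S]_b', (forall l, (u 0 l)@_0%MM = 0) /\ v = u *m G)
    exM _ _ _ (vhomog_mulmx hG hd) (sub_GM _).
- by exists 0; rewrite mul0mx; split=> // l; rewrite mxE mcoeff0.
- move=> _ _ [u [u0 ->]] [v [v0 ->]]; exists (u + v); rewrite mulmxDl.
  by split=> // l; rewrite mxE mcoeffD u0 v0 addr0.
- have [u ->] := gen_GM hv Mv; exists ('X_i *: u); rewrite scalemxAl; split=> // l.
  by rewrite mxE mcoeff_XM mnm0E.
have /minG/(_ k) : (delta_mx 0 k - u') *m G = 0 by rewrite mulmxBl def_u subrr.
by rewrite !mxE !eqxx mcoeffB mcoeff1 eqxx u0 subr0 => /eqP; rewrite oner_eq0.
Qed.

End Step.

Section FiniteGeneration.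
Variables (b : nat) (dg : 'I_b -> int) (M : 'rV[S]_b -> Prop).
(** The homogeneous vectors of degree [a] form a space of finite dimension
    over the field; a family in [M] of maximal rank spans. *)
Lemma finite_span_deg a : exists m (A : 'M[S]_(m, b)),
  (forall k, vhomog dg a (row k A) /\ M (row k A)) /\
  forall v, vhomog dg a v -> M v -> exists u, v = u *m A.
Proof.
(* the monomials of the entries of a vector of degree [a] have degree below [B] *)
pose B := (\sum_k `|a - dg k|).+1%N.
pose N := #|{: 'I_b * 'X_{1..n < B}}|.
pose coord m (A : 'M[S]_(m, b)) : 'M[K]_(m, N) :=
  
  \matrix_(i, j) let c := enum_val (j : 'I_N) : 'I_b * 'X_{1..n < B} in (A i c.1)@_c.2.
pose good m (A : 'M[S]_(m, b)) := forall k, vhomog dg a (row k A) /\ M (row k A).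
pose P r := `[< exists m (A : 'M[S]_(m, b)), good m A /\ \rank (coord m A) = r >].
have exP : exists r, P r.
  by exists 0%N; apply/asboolP; exists 0%N, 0; split=> [[]//|]; rewrite [coord _ _]flatmx0 mxrank0.
have boundP r : P r -> (r <= N)%N.
  by case/asboolP => m [A [_ <-]]; apply: rank_leq_col.
case: (ex_maxnP exP boundP) => r /asboolP[m [A [gA rkA]]] max_r.
exists m, A; split=> // v hv Mv.
pose A' := col_mx A v.
have cA' : coord _ A' = col_mx (coord _ A) (coord _ v).
  apply/matrixP => i j; rewrite [LHS]mxE /A'.
  by case: (split_ordP i) => k ->; rewrite ?(col_mxEu, col_mxEd) mxE.
have gA' : good _ A'.
  by move=> k; case: (split_ordP k) => l ->; rewrite /A' (rowKu, rowKd) ?row_id.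
have le_r : (\rank (coord _ A') <= r)%N by apply: max_r; apply/asboolP; exists _, A'.
have sAA' : (coord _ A <= coord _ A')%MS by rewrite cA' -addsmxE addsmxSl.
have : (coord _ A' <= coord _ A)%MS.
  by rewrite -(mxrank_leqif_sup sAA') eqn_leq mxrankS //= rkA.
rewrite cA' -addsmxE addsmx_sub => /andP[_ /submxP[D def_v]].
exists (map_mx (@mpolyC n K) D); apply/rowP => k; apply/mpolyP => x.
have hom_coef (w : 'rV[S]_b) : vhomog dg a w -> (B <= mdeg x)%N -> (w 0 k)@_x = 0.
  move=> hw le_Bx; apply/eqP/negPn/negP; have /xhomogP := hw k; move=> /[apply].
  have : (`|a - dg k| <= \sum_k `|a - dg k|)%N by rewrite (bigD1 k) //= leq_addr.
  by move: le_Bx; rewrite /B; lia.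
have hA i : (B <= mdeg x)%N -> (A i k)@_x = 0.
  by have := hom_coef _ (proj1 (gA i)); rewrite mxE.
rewrite mxE raddf_sum /=.
under eq_bigr => i _ do rewrite mxE mcoeffCM.
have [lt_xB|le_Bx] := ltnP (mdeg x) B; last first.
  by rewrite hom_coef // big1 // => i _; rewrite hA ?mulr0.
have := congr1 (fun A : 'M_(1, _) => A 0 (enum_rank (k, BMultinom lt_xB))) def_v.
rewrite !mxE enum_rankK /= => ->.
by apply: eq_bigr => i _; rewrite mxE enum_rankK.
Qed.

End FiniteGeneration.
End Syzygies.

Section MinimalGenerators.
Variables (K : fieldType) (n : nat).
Local Notation S := {mpoly K[n]}.
Variables (b : nat) (dg : 'I_b -> int) (M : 'rV[S]_b -> Prop).
Hypothesis gM : graded_submod dg M.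

Definition generators b' (dg' : 'I_b' -> int) (G : 'M[S]_(b', b)) :=
  [/\ mx_homog dg dg' G, forall u, M (u *m G) &
      forall a v, vhomog dg a v -> M v -> exists u, v = u *m G].

Lemma gsub_mulmx b' (G : 'M[S]_(b', b)) u : (forall k, M (row k G)) -> M (u *m G).
Proof.
move=> MG; rewrite mulmx_sum_row; elim/big_ind: _ => [|x y|k _].
- exact: (gsub0 gM).
- exact: (gsubD gM).
- exact: (gsubZ gM).
Qed.

(** In each degree finitely many elements span, and by graded Nakayama the degrees
    up to [t] suffice; degrees below [a0] are empty. *)
Lemma finite_generation (t : int) : (forall a, t < a -> koszul_exact dg M 0 a) ->
  exists b' (dg' : 'I_b' -> int) G, generators dg' G.
Proof.
move=> exM; have [a0 lt_a0] := @vhomog_bounded_below K n b dg.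
have genN (N : nat) : exists b' (dg' : 'I_b' -> int) (G : 'M[S]_(b', b)),
    [/\ mx_homog dg dg' G, forall u, M (u *m G) &
      forall (a : int) v, a < a0 + N%:Z -> vhomog dg a v -> M v -> exists u, v = u *m G].
  elim: N => [|N [b1 [dg1 [G1 [hG1 MG1 genG1]]]]].
    exists 0%N, (fun=> 0), 0; split=> [[]//|u|a v lt_a hv _].
      by rewrite mulmx0; apply: (gsub0 gM).
    by exists 0; rewrite mulmx0; apply: lt_a0 hv; move: lt_a; lia.
  have [b2 [G2 [hG2 genG2]]] := finite_span_deg dg M (a0 + N%:Z).
  pose dg12 (k : 'I_(b1 + b2)) := if split k is inl l then dg1 l else a0 + N%:Z.
  have dg12l k : dg12 (lshift b2 k) = dg1 k by rewrite /dg12 (unsplitK (inl k)).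
  have dg12r k : dg12 (rshift b1 k) = a0 + N%:Z by rewrite /dg12 (unsplitK (inr k)).
  exists (b1 + b2)%N, dg12, (col_mx G1 G2); split=> [k l|u|a v lt_a hv Mv].
  - case: (split_ordP k) => k' ->; first by rewrite col_mxEu dg12l; apply: hG1.
    rewrite col_mxEd dg12r; have [/(_ l)] := hG2 k'.
    by rewrite mxE.
  - rewrite -[u]hsubmxK mul_row_col; apply: (gsubD gM) => //.
    by apply: gsub_mulmx => k; have [] := hG2 k.
  have [lt_aN|le_Na] := ltrP a (a0 + N%:Z).
    have [u ->] := genG1 _ _ lt_aN hv Mv.
    by exists (row_mx u 0); rewrite mul_row_col mul0mx addr0.
  have eq_a : a = a0 + N%:Z by move: lt_a le_Na; lia.
  rewrite eq_a in hv; have [u ->] := genG2 _ hv Mv.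
  by exists (row_mx 0 u); rewrite mul_row_col mul0mx add0r.
have [b' [dg' [G [hG MG genG]]]] := genN (`|t - a0|.+1)%N.
exists b', dg', G; split=> // a v.
have gen_high (N : nat) : forall (a : int) v, a < a0 + (`|t - a0|.+1)%:Z + N%:Z ->
    vhomog dg a v -> M v -> exists u, v = u *m G.
  elim: N => [|N IHN] {}a {}v lt_a; first by rewrite addr0 in lt_a; apply: genG.
  have [|le_a] := ltrP a (a0 + (`|t - a0|.+1)%:Z + N%:Z); first exact: IHN.
  have lt_ta : t < a by lia.
  apply: (koszul_exact0_ind gM (P := fun v => exists u, v = u *m G) (exM _ lt_ta)).
  - by exists 0; rewrite mul0mx.
  - by move=> _ _ [u ->] [w ->]; exists (u + w); rewrite mulmxDl.
  - move=> i w hw /(IHN _ _ _ hw)[|u ->]; first by lia.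
    by exists ('X_i *: u); rewrite scalemxAl.
by apply: (gen_high `|(a - a0)%R|.+1); lia.
Qed.

(** A generating family with as few members as possible is minimal in the
    sense of resolutions: a relation with a unit coefficient would make one of
    its members superfluous. *)
Lemma minimal_generators (t : int) : (forall a, t < a -> koszul_exact dg M 0 a) ->
  exists b' (dg' : 'I_b' -> int) G, generators dg' G /\
    forall u : 'rV[S]_b', u *m G = 0 -> forall k, (u 0 k)@_0%MM = 0.
Proof.
move=> /finite_generation[b0 gen0].
pose P b' := `[< exists (dg' : 'I_b' -> int) G, generators dg' G >].
have exP : exists b', P b' by exists b0; apply/asboolP.
case: (ex_minnP exP) => b' /asboolP[dg' [G [hG MG genG]]] min_b'.
exists b', dg', G; split=> // u uG0 k; apply/eqP/negPn/negP => uk_n0.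
case: b' dg' G hG MG genG min_b' k u uG0 uk_n0 => [|b'] dg' G hG MG genG min_b' k;
  first by case: k.
move=> u uG0 uk_n0.
pose w := vcomp dg' (dg' k) u.
have wG0 : w *m G = 0 by rewrite -(vcomp_mulmx _ _ hG) uG0; apply: vcomp_id (vhomog0 _ _).
have [c c_n0 wk] : exists2 c, c != 0 & w 0 k = c%:MP.
  exists (u 0 k)@_0%MM => //; rewrite mxE subrr.
  rewrite [LHS]xhomog0_const; last exact: xhomog_comp.
  by rewrite mcoeff_homog_comp mdeg0.
suff: P b' by move/min_b'; rewrite ltnn.
apply/asboolP; exists (dg' \o lift k), (row' k G); split=> [i l|v|a v hv Mv].
- by rewrite mxE; apply: hG.
- apply: gsub_mulmx => i; suff -> : row i (row' k G) = delta_mx 0 (lift k i) *m G by [].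
  by rewrite -rowE; apply/rowP => l; rewrite !mxE.
have [x ->] := genG _ _ hv Mv.
pose y := x - (x 0 k * c^-1%:MP) *: w.
have yk : y 0 k = 0.
  by rewrite mxE [X in _ + X]mxE [X in _ - X]mxE wk -mulrA -mpolyCM mulVf // mulr1 subrr.
exists (col' k y); have -> : x *m G = y *m G.
  by rewrite mulmxBl -scalemxAl wG0 scaler0 subr0.
apply/rowP => l; rewrite !mxE (bigD1_ord k) //= yk mul0r add0r.
by apply: eq_bigr => i _; rewrite !mxE.
Qed.

End MinimalGenerators.

(** * Resolutions of modules of finite length *)

Section Resolution.
Variables (K : fieldType) (n : nat).
Local Notation S := {mpoly K[n]}.

(** A step of the resolution: the module [stage_sub] to be resolved next, with the
    vanishing of its Koszul homology that provides the finite generation of all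
    later syzygies. *)
Record stage := Stage {
  stage_rank : nat;
  stage_deg : 'I_stage_rank -> int;
  stage_sub : 'rV[S]_stage_rank -> Prop;
  stage_reg : int;
  stage_graded : graded_submod stage_deg stage_sub;
  stage_exact : forall p a, stage_reg + p%:Z < a ->
    koszul_exact stage_deg stage_sub p a }.

Record mingens (X : stage) := Mingens {
  mg_rank : nat;
  mg_deg : 'I_mg_rank -> int;
  mg_mx : 'M[S]_(mg_rank, stage_rank X);
  mg_gen : generators (@stage_deg X) (@stage_sub X) mg_deg mg_mx;
  mg_min : forall u : 'rV[S]_mg_rank, u *m mg_mx = 0 -> forall k, (u 0 k)@_0%MM = 0 }.

Lemma mingens_of (X : stage) : mingens X.
Proof.
have exX a : stage_reg X < a -> koszul_exact (@stage_deg X) (@stage_sub X) 0 a.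
  by move=> lt_a; apply: stage_exact; rewrite addr0.
have [b' /cid[dg' /cid[G [genG minG]]]] := cid (minimal_generators (stage_graded X) exX).
exact: Mingens genG minG.
Qed.

Lemma syz_graded (X : stage) :
  graded_submod (@mg_deg _ (mingens_of X)) (syzygies (mg_mx (mingens_of X))).
Proof. by have [hG _ _] := mg_gen (mingens_of X); apply: graded_syzygies hG. Qed.

Lemma syz_exact (X : stage) p a :
  koszul_exact (@stage_deg X) (@stage_sub X) p.+1 a <->
  koszul_exact (@mg_deg _ (mingens_of X)) (syzygies (mg_mx (mingens_of X))) p a.
Proof.
have [hG MG genG] := mg_gen (mingens_of X).
exact: (koszul_exact_syzygies hG MG genG (@mg_min _ (mingens_of X))).
Qed.

Lemma syz_reg (X : stage) p a : stage_reg X + 1 + p%:Z < a ->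
  koszul_exact (@mg_deg _ (mingens_of X)) (syzygies (mg_mx (mingens_of X))) p a.
Proof. by move=> lt_a; apply/syz_exact/stage_exact; move: lt_a; lia. Qed.

Definition next_stage (X : stage) : stage :=
  Stage (syz_graded X) (@syz_reg X).

Fixpoint nth_stage (X : stage) i : stage :=
  if i is i'.+1 then next_stage (nth_stage X i') else X.

Lemma nth_stage_reg X i : stage_reg (nth_stage X i) = stage_reg X + i%:Z.
Proof. by elim: i => [|i IHi] /=; rewrite ?addr0 // IHi; lia. Qed.

Lemma next_stage_deg X k : @stage_deg (next_stage X) k <= stage_reg X.
Proof.
have [hG MG genG] := mg_gen (mingens_of X).
rewrite real_leNgt ?num_real //; apply/negP => lt_k.
have exX : koszul_exact (@stage_deg X) (@stage_sub X) 0 (@stage_deg (next_stage X) k).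
  by apply: stage_exact; rewrite addr0.
have := koszul_exact0_gen hG MG genG (@mg_min _ (mingens_of X)) (stage_graded X) exX.
by move=> /(_ k); rewrite eqxx.
Qed.

Lemma next_stage_gen X a : ~ koszul_exact (@stage_deg X) (@stage_sub X) 0 a ->
  exists k, @stage_deg (next_stage X) k = a.
Proof.
move=> nexX; have [hG MG genG] := mg_gen (mingens_of X).
apply: contrapT => no_k; apply: nexX.
apply: (koszul_exact0_no_gen hG MG genG) => k.
by apply/eqP => eq_a; apply: no_k; exists k.
Qed.

Lemma nth_stage_exact X i p a :
  koszul_exact (@stage_deg (nth_stage X i)) (@stage_sub (nth_stage X i)) p a <->
  koszul_exact (@stage_deg X) (@stage_sub X) (i + p)%N a.
Proof.
elim: i p => [|i IHi] p //; rewrite addSnnS.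
exact: iff_trans (iff_sym (syz_exact _ _ _)) (IHi p.+1).
Qed.

End Resolution.

Section TopClass.
Variables (K : fieldType) (n : nat).
Local Notation S := {mpoly K[n]}.

Fixpoint koszul_top (V : lmodType S) (s : seq 'I_n) : V -> koszul V s :=
  match s return V -> koszul V s with
  | [::] => id
  | i :: s' => fun v => (0, koszul_top s' v)
  end.

Lemma koszul_all_topE (V : lmodType S) (Q : nat -> V -> Prop) s v :
  koszul_all Q (koszul_top s v) -> Q (size s) v.
Proof. by elim: s Q => //= i s IHs Q [_ /IHs]. Qed.

Lemma koszul_all_top (V : lmodType S) (Q : nat -> V -> Prop) s v :
  (forall q, (q < size s)%N -> Q q 0) -> Q (size s) v ->
  koszul_all Q (koszul_top s v).
Proof.
elim: s Q => [|i s IHs] Q //= Q0 Qv; split; last by apply: IHs => [q lt_q|//]; apply: Q0.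
elim: (s) (Q) Q0 => [|j s' IH] R R0 /=; first exact: R0.
by split; apply: IH => q lt_q; apply: R0; rewrite /=; lia.
Qed.

Lemma koszul_all_eq0 (V : lmodType S) (Q : nat -> V -> Prop) s (w : koszul V s) :
  (forall q v, (q <= size s)%N -> Q q v -> v = 0) -> koszul_all Q w -> w = 0.
Proof.
elim: s Q w => [|i s IHs] Q w Q0 /=; first exact: Q0.
case: w => a c /= [Qa Qc]; congr (_, _).
  by apply: IHs Qa => q v le_q; apply: Q0; rewrite /=; lia.
by apply: IHs Qc => q v le_q; apply: Q0.
Qed.

(** An element outside the submodule whose products with the variables lie in it
    is a cycle of homological degree [n] of the quotient, where there are no
    boundaries; its boundary in the free module is the class sought. *)
Lemma koszul_socle b (dg : 'I_b -> int) (M : 'rV[S]_b -> Prop) a v :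
    (0 < n)%N -> graded_submod dg M -> vhomog dg a v -> ~ M v ->
    (forall i, M ('X_i *: v)) ->
  ~ koszul_exact dg M n.-1 (a + n%:Z).
Proof.
move=> n_gt0 gM hv nMv MXv exM; apply: nMv.
have szE : size (enum 'I_n) = n by rewrite size_enum_ord.
have def_n : n = n.-1.+1 by rewrite prednK.
pose t := koszul_top (enum 'I_n) v.
pose Q q (u : 'rV[S]_b) := if q == n then u = v else u = 0.
have Qt : koszul_all Q t.
  apply: koszul_all_top => [q|]; rewrite szE /Q ?eqxx // => lt_qn.
  by rewrite (ltn_eqF lt_qn).
have Qdt : koszul_all (koszul_deg dg M n.-1 (a + n%:Z)) (koszul_diff t).
  apply: koszul_all_diff Qt => [q|q x y|q c x|i q x].
  - exact: koszul_deg0.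
  - exact: koszul_degD.
  - exact: koszul_degZ.
  rewrite /Q /koszul_deg [in _ == n]def_n eqSS; case: eqP => _ ->; last by rewrite scaler0.
  split=> //; have -> : a + n%:Z - n.-1%:Z = 1 + a by lia.
  by apply: vhomogZ => //; apply: xhomogX.
have [w Qw dw] := exM _ Qdt (koszul_diffK _).
have Qtw : koszul_all (koszul_deg dg (fun=> True) n (a + n%:Z)) (t - w).
  apply: koszul_allD => [q x y||]; first exact: koszul_degD.
    apply: koszul_all_sub Qt => q x; rewrite /Q /koszul_deg.
    by case: eqP => // _ ->; rewrite addrK.
  rewrite -scaleN1r -mpolyC1 -mpolyCN; rewrite -def_n in Qw.
  apply: koszul_allZ Qw => q x /(koszul_degZ gM (-1)).
  by apply: koszul_deg_sub.
have [||u Qu du] := koszul_acyclic Qtw.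
- by rewrite koszul_diffB dw subrr.
- by move=> n0; rewrite n0 in n_gt0.
have u0 : u = 0.
  apply: koszul_all_eq0 Qu => q x; rewrite szE /koszul_deg => le_qn.
  by rewrite ltn_eqF.
move: du; rewrite u0 koszul_diff0 => /esym/eqP; rewrite subr_eq0 => /eqP eq_tw.
move: Qw; rewrite -eq_tw => /koszul_all_topE; rewrite szE /koszul_deg -def_n eqxx.
by case.
Qed.

End TopClass.

(** Here [M] is the module of relations of [N]: the last two hypotheses say that
    [N] vanishes beyond degree [s], but not in degree [s]. Koszul homology of [M]
    then vanishes in degrees greater than [s + 1 + p], by acyclicity of the free
    module, and does not in homological degree [n - 1] and degree [s + n]. *)
Theorem has_reg_finite_length (K : fieldType) (n : nat) (N : grmod {mpoly K[n]})
    (b : nat) (gen : 'I_b -> N) (s : nat)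
    (M := fun u : 'rV[{mpoly K[n]}]_b => \sum_k u 0 k *: gen k = 0) :
    (0 < n)%N ->
    (forall k, gr_comp 0 (gen k)) ->
    (forall d z, @gr_comp _ N d z ->
       exists u : 'rV[{mpoly K[n]}]_b, z = \sum_k u 0 k *: gen k) ->
    graded_submod (fun=> 0) M ->
    (forall u, M u -> forall k, (u 0 k)@_0%MM = 0) ->
    (forall a v, s%:Z < a -> vhomog (fun=> 0) a v -> M v) ->
    (exists2 v, vhomog (fun=> 0) s%:Z v & ~ M v) ->
  has_reg N s%:Z.
Proof.
move=> n_gt0 gen0 surj gM minM bigM [v0 hv0 nMv0].
have exM p a : (s%:Z + 1) + p%:Z < a -> koszul_exact (fun=> 0) M p a.
  move=> lt_a w Qw dw.
  have Qw' : koszul_all (koszul_deg (fun=> 0) (fun=> True) p a) w.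
    by apply: koszul_all_sub Qw => q v; apply: koszul_deg_sub.
  have [|v Qv dv] := koszul_acyclic Qw' dw.
    move=> p0 k; apply: minM.
    by have := koszul_all_out0 Qw; rewrite /koszul_deg p0 => -[].
  exists v => //; apply: koszul_all_sub Qv => q u; apply: koszul_deg_sub => x hx _.
  by apply: bigM hx; move: lt_a; lia.
pose X0 : stage K n := Stage gM exM.
pose X i := nth_stage X0 i.
have genX i := mg_gen (mingens_of (X i)).
have minX i := @mg_min _ _ _ (mingens_of (X i)).
unshelve refine (ex_intro _ (@MinFreeRes _ _ N (fun i => stage_rank (X i))
  (fun i => @stage_deg _ _ (X i)) (fun i => mg_mx (mingens_of (X i))) gen _ _ _ _ _ _) _).
- exact: gen0.
- by move=> i k l; have [hG _ _] := genX i; apply: hG.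
- by move=> d z /surj.
- move=> u; split=> [Mu|[v ->]]; last by have [_ MG _] := genX 0%N; apply: MG.
  have [_ MG genG] := genX 0%N.
  have [L def_u] := vcomp_sum (fun=> 0) u.
  rewrite def_u; elim: L {def_u} => [|a L [v IHL]].
    by exists 0; rewrite big_nil mul0mx.
  have [v' def_v'] := genG _ _ (@vhomog_comp K n _ _ a u) (gsub_comp gM a Mu).
  by exists (v' + v); rewrite big_cons IHL mulmxDl; congr (_ + _).
- move=> i u; split=> [Mu|[v ->]]; last first.
    by have [_ MG _] := genX i.+1; have := MG v.
  have [_ MG genG] := genX i.+1.
  have [L def_u] := vcomp_sum (@stage_deg _ _ (X i.+1)) u.
  rewrite def_u; elim: L {def_u} => [|a L [v IHL]].
    by exists 0; rewrite big_nil mul0mx.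
  have [v' def_v'] := genG _ _ (@vhomog_comp K n _ _ a u) (gsub_comp (stage_graded (X i.+1)) a Mu).
  by exists (v' + v); rewrite big_cons IHL mulmxDl; congr (_ + _).
- move=> i k l /=; have [_ MG _] := genX i.
  have := MG (delta_mx 0 k); rewrite -rowE.
  suff min_sub u : @stage_sub _ _ (X i) u -> forall l, (u 0 l)@_0%MM = 0.
    by move/min_sub/(_ l); rewrite mxE.
  by case: i u {k l MG} => [|i] u; [apply: minM|apply: minX].
split=> /=.
  have nexM : ~ koszul_exact (fun=> 0) M n.-1 (s%:Z + n%:Z).
    apply: (koszul_socle n_gt0 gM hv0 nMv0) => i; apply: (bigM (1 + s%:Z)); first by lia.
    by apply: vhomogZ hv0; apply: xhomogX.
  have [] := @next_stage_gen _ _ (X n.-1) (s%:Z + n%:Z).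
    by move/nth_stage_exact; rewrite addn0; apply: nexM.
  move=> k dgk; exists n.-1.+1, k; rewrite [X in X - _]dgk prednK //; lia.
case=> [|i] k; first by rewrite subr0.
have : @stage_deg _ _ (X i.+1) k <= _ := next_stage_deg k.
rewrite nth_stage_reg /= => le_dg; rewrite lerBlDr (Order.POrderTheory.le_trans le_dg) // -addrA lerD2l; lia.
Qed.

(** * Bigraded representations of sl2 *)

Section IterAdditive.
Variables (V : zmodType) (E : {additive V -> V}).

Lemma iter_raddfD k : {morph iter k E : u v / u + v}.
Proof. by elim: k => [|k IHk] u v //; rewrite !iterS IHk raddfD. Qed.

Lemma iter_raddf0 k : iter k E 0 = 0.
Proof. by elim: k => [|k IHk] //; rewrite iterS IHk raddf0. Qed.

Lemma iter_raddfMz k z : {morph iter k E : u / u *~ z}.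
Proof. by elim: k => [|k IHk] u //; rewrite !iterS IHk raddfMz. Qed.

End IterAdditive.

(** The raising and lowering operators of an action of sl2 on a bigraded group, in
    which bidegree [(a, b)] has weight [a - b]. The nonnegativity of both degrees
    makes the operators locally nilpotent, and the last two fields stand for
    rational scalars. *)
Record sl2_triple (V : zmodType) (E F : V -> V) (W : int -> int -> V -> Prop) : Prop := {
  sl2D : forall a b u v, W a b u -> W a b v -> W a b (u + v);
  sl2N : forall a b u, W a b u -> W a b (- u);
  sl2E : forall a b v, W a b v -> W (a + 1) (b - 1) (E v);
  sl2F : forall a b v, W a b v -> W (a - 1) (b + 1) (F v);
  sl2_bracket : forall a b v, W a b v -> E (F v) - F (E v) = v *~ (a - b);
  sl2_negl : forall a b v, W a b v -> a < 0 -> v = 0;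
  sl2_negr : forall a b v, W a b v -> b < 0 -> v = 0;
  sl2_torsion : forall v k, (0 < k)%N -> v *+ k = 0 :> V -> v = 0;
  sl2_div : forall a b v k, (0 < k)%N -> W a b v -> exists2 u, W a b u & u *+ k = v }.

Lemma sl2_swap (V : zmodType) (E F : V -> V) W :
  sl2_triple E F W -> sl2_triple F E (fun a b => W b a).
Proof.
move=> [WD WN WE WF br negl negr tor div]; split=> // a b.
- by move=> u v; apply: WD.
- by move=> u; apply: WN.
- by move=> v; apply: WF.
- by move=> v; apply: WE.
- by move=> v /br EF; rewrite -opprB EF -mulrNz opprB.
- by move=> v; apply: negr.
- by move=> v; apply: negl.
- by move=> v; apply: div.
Qed.

Section SL2.
Variables (V : zmodType) (E F : {additive V -> V}) (W : int -> int -> V -> Prop).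
Hypothesis sl2 : sl2_triple E F W.

Lemma sl2_iter k a b v : W a b v -> W (a + k%:Z) (b - k%:Z) (iter k E v).
Proof.
elim: k => [|k IHk] Wv; first by rewrite addr0 subr0.
have -> : a + k.+1%:Z = a + k%:Z + 1 by lia.
have -> : b - k.+1%:Z = b - k%:Z - 1 by lia.
exact: (sl2E sl2 (IHk Wv)).
Qed.

Lemma sl2_torsionz (v : V) z : z != 0 -> v *~ z = 0 -> v = 0.
Proof.
case: z => [[|k]|k] // _; first by move=> h; apply: (sl2_torsion sl2 (k := k.+1)).
move=> /eqP; rewrite NegzE mulrNz oppr_eq0 => /eqP h.
exact: (sl2_torsion sl2 (k := k.+1)).
Qed.

Lemma sl2_iter_comm k a b v : W a b v ->
  iter k.+1 E (F v) = F (iter k.+1 E v) + iter k E v *~ (k.+1%:Z * (a - b + k%:Z)).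
Proof.
move=> Wv; elim: k => [|k IHk].
  by rewrite /= mul1r addr0 -(sl2_bracket sl2 Wv) addrC subrK.
rewrite iterS IHk raddfD raddfMz -iterS.
have -> : E (F (iter k.+1 E v)) = F (iter k.+2 E v) +
    iter k.+1 E v *~ (a + k.+1%:Z - (b - k.+1%:Z)).
  by rewrite -(sl2_bracket sl2 (sl2_iter k.+1 Wv)) addrC subrK.
by rewrite -addrA -mulrzDr; congr (_ + _ *~ _); lia.
Qed.

End SL2.

Section SL2Theory.
Variables (V : zmodType) (E F : {additive V -> V}) (W : int -> int -> V -> Prop).
Hypothesis sl2 : sl2_triple E F W.

(** Injectivity of raising from a weight to the opposite one. By induction on
    the first degree, [F v] vanishes as it is killed by a higher power of [E];
    then [v] is a lowest weight vector and each step of the chain of its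
    images can be undone by [F], up to a nonzero factor. *)
Lemma sl2_inj r a b v : W a b v -> a - b = - r%:Z -> iter r E v = 0 -> v = 0.
Proof.
have [N] : exists N : nat, a < N%:Z by exists `|a|.+1; lia.
elim: N a b v r => [|N IHN] a b v r lt_aN Wv ab Erv; first exact: (sl2_negl sl2 Wv).
have Fv : F v = 0.
  apply: (IHN _ _ _ r.+2 _ (sl2F sl2 Wv)); [by lia|by lia|].
  by rewrite (sl2_iter_comm sl2 _ Wv) !iterS Erv !raddf0 mul0rz addr0.
suff down j : (j <= r)%N -> iter (r - j) E v = 0 by have := down r; rewrite subnn; apply.
elim: j => [|j IHj] lt_jr; first by rewrite subn0.
have := sl2_iter_comm sl2 (r - j.+1) Wv.
have -> : ((r - j.+1).+1 = r - j)%N by lia.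
rewrite Fv iter_raddf0 IHj ?raddf0 ?add0r; last by lia.
by move=> /esym; apply: (sl2_torsionz sl2); rewrite mulf_neq0 //; lia.
Qed.

(** On a highest weight vector [E] undoes the powers of [F] within the weight
    string, up to a nonzero factor. *)
Lemma sl2_highest k a b w : W a b w -> E w = 0 -> k%:Z <= a - b ->
  exists2 c, (0 < c)%N & iter k E (iter k F w) = w *+ c.
Proof.
move=> Ww Ew; elim: k => [|k IHk] le_k; first by exists 1%N; rewrite //= mulr1n.
have [|c c_gt0 def_c] := IHk; first by lia.
have := sl2_iter_comm (sl2_swap sl2) k Ww.
rewrite Ew iter_raddf0 => /esym/eqP; rewrite addr_eq0 -mulrNz => /eqP EFk.
exists (c * (k.+1 * `|(a - b - k%:Z)%R|))%N; first by rewrite !muln_gt0 c_gt0 /=; lia.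
rewrite iterSr EFk iter_raddfMz def_c !pmulrn -mulrzA; congr (_ *~ _).
by rewrite PoszM PoszM; lia.
Qed.

(** Surjectivity onto the weights that are at least [r]: by induction on the
    second degree the target can be corrected to a highest weight vector. *)
Lemma sl2_surj r a b w : W a b w -> r%:Z <= a - b ->
  exists2 v, W (a - r%:Z) (b + r%:Z) v & iter r E v = w.
Proof.
have [N] : exists N : nat, b < N%:Z by exists `|b|.+1; lia.
elim: N a b w r => [|N IHN] a b w r lt_bN Ww le_r.
  exists 0; last by rewrite (sl2_negr sl2 Ww lt_bN) iter_raddf0.
  have := sl2_iter (sl2_swap sl2) r Ww.
  by rewrite (sl2_negr sl2 Ww lt_bN) iter_raddf0.
have [||v Wv Ev] := IHN _ _ _ r.+1 _ (sl2E sl2 Ww); [by lia|by lia|].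
have Wv1 : W (a - r%:Z) (b + r%:Z) v.
  have <- : a + 1 - r.+1%:Z = a - r%:Z by lia.
  by have <- : b - 1 + r.+1%:Z = b + r%:Z by lia.
pose u := w - iter r E v.
have Wu : W a b u.
  apply: (sl2D sl2 Ww); apply: (sl2N sl2).
  by have := sl2_iter sl2 r Wv1; rewrite subrK addrK.
have Eu : E u = 0 by rewrite raddfB -iterS Ev subrr.
have [c c_gt0 def_c] := sl2_highest Wu Eu le_r.
have [v' Wv' def_v'] := sl2_div sl2 c_gt0 (sl2_iter (sl2_swap sl2) r Wu).
exists (v' + v); first exact: (sl2D sl2 Wv').
suff Ev' : iter r E v' = u by rewrite iter_raddfD Ev' /u subrK.
apply/eqP; rewrite -subr_eq0; apply/eqP; apply: (sl2_torsion sl2 c_gt0).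
rewrite mulrnBl -def_c -def_v' [v' *+ c]pmulrn iter_raddfMz pmulrn subrr //.
Qed.

(** If [E^r v] is a highest weight vector then [E^(r + 1) v = 0], where [v] has
    weight [- (r + 1)], so that [sl2_inj] applies. *)
Lemma sl2_not_image r a b w v : W a b w -> E w = 0 -> a - b = r%:Z - 1 ->
  W (a - r%:Z) (b + r%:Z) v -> iter r E v = w -> w = 0.
Proof.
move=> Ww Ew ab Wv Erv.
have v0 : v = 0 by apply: (@sl2_inj r.+1 _ _ v Wv); [lia|rewrite iterS Erv].
by rewrite -Erv v0 iter_raddf0.
Qed.

End SL2Theory.

(** * Polarization operators *)

Section Polarization.
Variables (K : fieldType) (n : nat) (lam : 'I_n -> K).
Local Notation S := {mpoly K[n]}.
Local Notation T := {mpoly S[n]}.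
Implicit Types (p q : T).

Definition mderivx (i : 'I_n) : T -> T := map_mpoly (mderiv i).

Lemma mcoeff_mderivx i p m : (mderivx i p)@_m = (p@_m)^`M(i).
Proof. exact: mcoeff_map_mpoly. Qed.

Lemma mderivxZ i (c : S) p : mderivx i (c *: p) = c^`M(i) *: p + c *: mderivx i p.
Proof.
by apply/mpolyP => m; rewrite mcoeffD !(mcoeffZ, mcoeff_mderivx) mderivM.
Qed.

Lemma mderivx_deriv i j p : mderivx i (p^`M(j)) = (mderivx i p)^`M(j).
Proof.
by apply/mpolyP => m; rewrite !(mcoeff_deriv, mcoeff_mderivx) mderivMn.
Qed.

Lemma mderiv_varE (R : comNzRingType) i j : ('X_j : {mpoly R[n]})^`M(i) = (j == i)%:R.
Proof.
rewrite mderivX mnm1E; case: eqP => [->|_]; last by rewrite scale0r.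
by rewrite scale1r -[X in (X - _)%MM]add0m addmK mpolyX0.
Qed.

Lemma mcoeff_XderivX (R : comNzRingType) i (c : {mpoly R[n]}) m :
  ('X_i * c^`M(i))@_m = c@_m *+ m i.
Proof.
rewrite mcoeff_XM mcoeff_deriv; case: eqP => [->|/eqP mi_n0]; first by rewrite mulr0n.
have -> : ((m - U_(i))%MM i).+1 = m i by rewrite mnmBE mnm1E eqxx subn1 prednK ?lt0n.
by rewrite submK //; apply/mnm_lepP => j; rewrite mnm1E; case: eqP => // <-; rewrite lt0n.
Qed.

(** The polarization [sum_i lam_i x_i d/du_i], where the outer variables stand for
    the [u_i] and the inner ones for the [x_i]. *)
Definition polar p : T := \sum_i ((lam i)%:MP * 'X_i) *: p^`M(i).

(** The lowering operator [sum_i lam_i^-1 u_i d/dx_i]: with the inverse weights the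
    bracket with [polar] does not involve [lam]. *)
Definition polar' p : T := \sum_i ((lam i)^-1)%:MP *: ('X_i * mderivx i p).

Fact polar_linear : linear polar.
Proof.
move=> c p q; rewrite scaler_sumr -big_split; apply: eq_bigr => i _ /=.
by rewrite mderivD mderivZ scalerDr !scalerA mulrC.
Qed.
HB.instance Definition _ := GRing.isLinear.Build S T T *:%R polar polar_linear.

Fact polar'_additive : zmod_morphism polar'.
Proof.
move=> p q; rewrite -sumrB; apply: eq_bigr => i _.
by rewrite /mderivx raddfB mulrBr scalerBr.
Qed.
HB.instance Definition _ := GRing.isZmodMorphism.Build T T polar' polar'_additive.

Hypothesis lam_n0 : forall i, lam i != 0.

Let sum_exchange_sub (V : zmodType) (I : finType) (t : I -> I -> V) (f g : I -> V) :
  \sum_i (\sum_j t i j + f i) - \sum_j (\sum_i t i j + g j) = \sum_i (f i - g i).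
Proof.
rewrite !big_split [\sum_j \sum_i t i j]exchange_big /= opprD addrACA subrr add0r.
by rewrite -sumrN.
Qed.

Lemma polar_bracket p : polar (polar' p) - polar' (polar p) =
  \sum_i ('X_i *: mderivx i p - 'X_i * p^`M(i)).
Proof.
pose c i : S := (lam i)%:MP; pose d i : S := ((lam i)^-1)%:MP.
have cd i : c i * d i = 1 by rewrite -mpolyCM mulfV.
pose t i j := (c i * 'X_i * d j) *: ('X_j * (mderivx j p)^`M(i)).
have -> : polar (polar' p) = \sum_i (\sum_j t i j + 'X_i *: mderivx i p).
  apply: eq_bigr => i _; rewrite /polar' [(\sum_j _)^`M(i)]raddf_sum scaler_sumr /=.
  have -> : 'X_i *: mderivx i p = \sum_j (if j == i then 'X_i *: mderivx i p else 0).
    by rewrite -big_mkcond big_pred1_eq.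
  rewrite -big_split; apply: eq_bigr => j _ /=.
  set q := mderivx j p; set q' := 'X_i *: mderivx i p.
  rewrite mderivZ scalerA mderivM mderiv_varE scalerDr [LHS]addrC; congr (_ + _).
  rewrite {}/q {}/q'; case: (j =P i) => [->|_]; last by rewrite mul0r scaler0.
  by rewrite mul1r mulrAC cd mul1r.
have -> : polar' (polar p) = \sum_j (\sum_i t i j + 'X_j * p^`M(j)).
  apply: eq_bigr => j _; rewrite /polar [mderivx j _]raddf_sum mulr_sumr scaler_sumr /=.
  have -> : 'X_j * p^`M(j) = \sum_i (if i == j then 'X_j * p^`M(j) else 0).
    by rewrite -big_mkcond big_pred1_eq.
  rewrite -big_split; apply: eq_bigr => i _ /=.
  rewrite -/(mderivx j _) mderivxZ mderivx_deriv mderiv_mulC mderiv_varE mulrDr scalerDr.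
  rewrite [LHS]addrC; congr (_ + _).
    by rewrite -scalerAr scalerA /t; congr (_ *: _); rewrite mulrC.
  case: (i =P j) => [->|_]; last by rewrite mulr0 scale0r mulr0 scaler0.
  by rewrite mulr1 -scalerAr scalerA [d j * _]mulrC cd scale1r.
exact: sum_exchange_sub.
Qed.

End Polarization.

Section Bihomogeneous.
Variables (K : fieldType) (n : nat).
Local Notation S := {mpoly K[n]}.
Local Notation T := {mpoly S[n]}.
Implicit Types (p q : T) (a b : int).

Lemma bihomog0 a b : bihomog a b (0 : T).
Proof. by move=> my mx; rewrite !mcoeff0 eqxx. Qed.

Lemma bihomogD a b p q : bihomog a b p -> bihomog a b q -> bihomog a b (p + q).
Proof.
move=> hp hq my mx; have [p0|/hp] := eqVneq (p@_my)@_mx 0; last by [].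
by rewrite !mcoeffD p0 add0r => /hq.
Qed.

Lemma bihomogN a b p : bihomog a b p -> bihomog a b (- p).
Proof. by move=> hp my mx; rewrite !mcoeffN oppr_eq0 => /hp. Qed.

Lemma bihomog_sum a b I (s : seq I) (P : pred I) (F : I -> T) :
  (forall i, P i -> bihomog a b (F i)) -> bihomog a b (\sum_(i <- s | P i) F i).
Proof. by move=> hF; elim/big_ind: _ => //; [apply: bihomog0|apply: bihomogD]. Qed.

Lemma bihomogZ a b d (c : S) p :
  xhomog d c -> bihomog a b p -> bihomog (a + d) b (c *: p).
Proof.
move=> hc hp my mx; rewrite mcoeffZ -mcoeff_msupp => /msuppM_le.
case/allpairsP=> -[m1 m2] /= [/hc <-]; rewrite mcoeff_msupp => /hp[<- <-] ->.
by rewrite mdegD; split=> //; lia.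
Qed.

Lemma bihomogM a b a' b' p q :
  bihomog a b p -> bihomog a' b' q -> bihomog (a + a') (b + b') (p * q).
Proof.
move=> hp hq my mx; rewrite mcoeffM raddf_sum /= => nz.
have [k /eqP def_my] : exists2 k : 'X_{1..n < (mdeg my).+1, (mdeg my).+1},
    my == (k.1 + k.2)%MM & (p@_k.1 * q@_k.2)@_mx != 0.
  apply: contrapT => no_k; move: nz; rewrite big1 ?eqxx // => k def_my.
  by apply/eqP/negPn/negP => nz; apply: no_k; exists k.
rewrite -mcoeff_msupp => /msuppM_le/allpairsP[[m1 m2] /=].
rewrite !mcoeff_msupp => -[/hp[hm1 hk1] /hq[hm2 hk2] ->].
have -> : mdeg my = (mdeg k.1 + mdeg k.2)%N by rewrite -mdegD -def_my.
by rewrite mdegD; split; lia.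
Qed.

Lemma bihomogU i : bihomog 0 1 ('X_i : T).
Proof.
move=> my mx; rewrite mcoeffX; case: (U_(i)%MM =P my) => [<-|_]; last first.
  by rewrite mcoeff0 eqxx.
by rewrite mcoeff1 mdeg1; case: (mx =P 0%MM) => [->|_]; rewrite ?mdeg0 // eqxx.
Qed.

Lemma bihomog_deriv a b i p : bihomog a b p -> bihomog a (b - 1) p^`M(i).
Proof.
move=> hp my mx; rewrite mcoeff_deriv mcoeffMn -mulr_natr mulf_eq0 negb_or.
by case/andP=> /hp[<- <-] _; rewrite mdegD mdeg1; split; lia.
Qed.

Lemma bihomog_derivx a b i p : bihomog a b p -> bihomog (a - 1) b (mderivx i p).
Proof.
move=> hp my mx; rewrite mcoeff_mderivx mcoeff_deriv -mulr_natr mulf_eq0 negb_or.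
by case/andP=> /hp[<- <-] _; rewrite mdegD mdeg1; split; lia.
Qed.

Lemma xhomogC (c : K) : xhomog 0 (c%:MP : S).
Proof.
by move=> m; rewrite msuppC; case: ifP => // _; rewrite inE => /eqP ->; rewrite mdeg0.
Qed.

Section CharacteristicZero.
Hypothesis charK : [pchar K] =i pred0.
Variable lam : 'I_n -> K.
Hypothesis lam_n0 : forall i, lam i != 0.

Lemma char0_natr k : (k%:R == 0 :> K) = (k == 0)%N.
Proof. by have /pcharf0P := charK. Qed.

Lemma bihomog_polar a b p : bihomog a b p -> bihomog (a + 1) (b - 1) (polar lam p).
Proof.
move=> hp; apply: bihomog_sum => i _; apply: bihomogZ; last exact: bihomog_deriv.
by rewrite -[1]add0r; apply: xhomogM; [apply: xhomogC|apply: xhomogX].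
Qed.

Lemma bihomog_polar' a b p : bihomog a b p -> bihomog (a - 1) (b + 1) (polar' lam p).
Proof.
move=> hp; apply: bihomog_sum => i _; rewrite -[a - 1]addr0.
apply: bihomogZ; first exact: xhomogC.
rewrite -[a - 1]add0r [b + 1]addrC.
by apply: bihomogM; [apply: bihomogU|apply: bihomog_derivx].
Qed.

(** The bracket of the two polarizations is the difference of the Euler fields in
    the [x_i] and in the [u_i], which acts on bihomogeneous polynomials as the
    difference of the degrees. *)
Lemma polar_sl2 : sl2_triple (polar lam) (polar' lam) (@bihomog K n).
Proof.
split.
- exact: bihomogD.
- exact: bihomogN.
- exact: bihomog_polar.
- exact: bihomog_polar'.
- move=> a b p hp; rewrite polar_bracket //; apply/mpolyP => my; apply/mpolyP => mx.
  rewrite !raddf_sum raddfMz /= raddfMz /=.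
  under eq_bigr => i _ do
    rewrite mcoeffB mcoeffZ mcoeff_mderivx mcoeffB !mcoeff_XderivX mcoeffMn.
  rewrite sumrB !sumrMnr -!mdegE.
  have [->|/hp[<- <-]] := eqVneq (p@_my)@_mx 0; first by rewrite !mul0rn mul0rz subrr.
  by rewrite mulrzBr -!pmulrn.
- move=> a b p hp lt_a; apply/mpolyP => my; apply/mpolyP => mx; rewrite !mcoeff0.
  by apply/eqP/negPn/negP => /hp[]; lia.
- move=> a b p hp lt_a; apply/mpolyP => my; apply/mpolyP => mx; rewrite !mcoeff0.
  by apply/eqP/negPn/negP => /hp[]; lia.
- move=> p k k_gt0 pk0; apply/mpolyP => my; apply/mpolyP => mx; rewrite !mcoeff0.
  have /eqP : ((p *+ k)@_my)@_mx = 0 by rewrite pk0 !mcoeff0.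
  by rewrite !mcoeffMn -mulr_natr mulf_eq0 char0_natr (gtn_eqF k_gt0) orbF => /eqP.
- move=> a b p k k_gt0 hp; exists ((k%:R^-1 : K)%:MP *: p).
    by rewrite -[a]addr0; apply: bihomogZ => //; apply: xhomogC.
  rewrite -scaler_nat scalerA -mpolyC_nat -mpolyCM mulfV ?scale1r //.
  by rewrite char0_natr -lt0n.
Qed.

Lemma polarM p q : polar lam (p * q) = polar lam p * q + p * polar lam q.
Proof.
rewrite /polar mulr_suml mulr_sumr -big_split; apply: eq_bigr => i _ /=.
by rewrite mderivM scalerDr scalerAl scalerAr.
Qed.

(** The minor [D = lam_i x_i u_j - lam_j x_j u_i] is killed by [E], which is a
    derivation killing the [x_i] as well; hence so is [x_i^e D^d]. *)
Lemma polar_highest (i j : 'I_n) (d e : nat) : i != j ->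
  exists w, [/\ bihomog (d + e)%N%:Z d%:Z w, polar lam w = 0 & w != 0].
Proof.
move=> ne_ij; pose c k : S := (lam k)%:MP * 'X_k.
have c1 k : xhomog 1 (c k).
  by rewrite -[1]add0r; apply: xhomogM; [apply: xhomogC|apply: xhomogX].
pose D : T := c i *: 'X_j - c j *: 'X_i.
have polarU k : polar lam 'X_k = (c k)%:MP.
  rewrite /polar (bigD1 k) //= big1 ?addr0 => [|l /negPf ne_lk].
    by rewrite mderiv_varE eqxx -mul_mpolyC mulr1.
  by rewrite mderiv_varE eq_sym ne_lk scaler0.
have hD : bihomog 1 1 D.
  rewrite -[X in bihomog X]add0r; apply: bihomogD; last apply: bihomogN;
  by apply: bihomogZ => //; apply: bihomogU.
have ED : polar lam D = 0.
  by rewrite raddfB /= !linearZ /= !polarU -!mul_mpolyC mulrN -!mpolyCM [c j * _]mulrC subrr.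
have D_n0 : D != 0.
  apply/eqP => /(congr1 (mcoeff U_(j))); rewrite mcoeffB !mcoeffZ !mcoeffXU eqxx.
  rewrite (negPf ne_ij) mulr1 mulr0 subr0 mcoeff0 => /eqP.
  rewrite mulf_eq0 mpolyC_eq0 (negPf (lam_n0 i)) /= => /eqP/(congr1 (mcoeff U_(i))).
  by rewrite mcoeffX eqxx mcoeff0 => /eqP; rewrite oner_eq0.
exists ('X_i ^+ e *: D ^+ d); split.
- have hX : xhomog e%:Z ('X_i ^+ e : S).
    elim: (e) => [|e' IHe]; first by rewrite expr0 -mpolyC1; apply: xhomogC.
    by rewrite exprS -add1n PoszD; apply: xhomogM => //; apply: xhomogX.
  rewrite PoszD; apply: bihomogZ => //; elim: (d) => [|d' IHd].
    move=> my mx; rewrite expr0 mcoeff1; case: (my =P 0%MM) => [->|_].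
      by rewrite mcoeff1; case: (mx =P 0%MM) => [->|_]; rewrite ?mdeg0 // eqxx.
    by rewrite mcoeff0 eqxx.
  by rewrite exprS -add1n PoszD; apply: bihomogM.
- rewrite linearZ /=; suff -> : polar lam (D ^+ d) = 0 by rewrite scaler0.
  elim: (d) => [|d' IHd]; last by rewrite exprS polarM ED IHd mul0r mulr0 addr0.
  by rewrite expr0 /polar big1 // => k _; rewrite -mpolyC1 mderivC scaler0.
- have Dd_n0 : D ^+ d != 0.
    elim: (d) => [|d' IHd]; first by rewrite expr0 oner_neq0.
    by rewrite exprS; apply/eqP => /mpoly_idomainAxiom; rewrite (negPf D_n0) (negPf IHd).
  have Xe_n0 : ('X_i : S) ^+ e != 0.
    elim: (e) => [|e' IHe]; first by rewrite expr0 oner_neq0.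
    rewrite exprS; apply/eqP => /mpoly_idomainAxiom; rewrite (negPf IHe) orbF => /eqP.
    by move/(congr1 (mcoeff U_(i))); rewrite mcoeffX eqxx mcoeff0 => /eqP; rewrite oner_eq0.
  apply: contraNneq Dd_n0 => /mpolyP wD; apply/eqP/mpolyP => m.
  have := wD m; rewrite mcoeffZ !mcoeff0 => /mpoly_idomainAxiom.
  by rewrite (negPf Xe_n0) => /eqP.
Qed.

End CharacteristicZero.
End Bihomogeneous.

(** * Inverse systems *)

Section InverseSystem.
Variables (K : fieldType) (n : nat).
Hypothesis charK : [pchar K] =i pred0.
Hypothesis n_gt0 : (0 < n)%N.
Local Notation S := {mpoly K[n]}.
Local Notation T := {mpoly S[n]}.
Implicit Types (p q : T) (m : 'X_{1..n}).

Lemma mcoeff_monM (R : comNzRingType) m' (q : {mpoly R[n]}) m :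
  ('X_[m'] * q)@_m = if (m' <= m)%MM then q@_(m - m') else 0.
Proof.
rewrite mulrC; case: ifP => [le_m|/negP nle_m].
  by rewrite -[in LHS](submK le_m) addmC mcoeffMX.
apply/eqP; rewrite mcoeff_eq0 (perm_mem (msuppMX _ _)); apply/negP => /mapP[m1 _ eq_m].
by apply: nle_m; rewrite eq_m lem_addr.
Qed.

(** The monomials [y^m] with [m] in the box of size [N] are those for which all the
    variables occur in the denominator of [y^m / (y_1 ... y_n)^N]; this fraction
    is then [y^(- mcpl N m - 1)]. *)
Definition box (N : nat) m := [forall i, (m i < N)%N].

Lemma boxP N m : reflect (forall i, (m i < N)%N) (box N m).
Proof. exact: forallP. Qed.

Lemma box_mdeg N m : box N m -> (mdeg m <= n * N)%N.
Proof.
move/boxP=> box_m; rewrite mdegE -[X in (_ <= X * _)%N]card_ord -sum_nat_const.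
by apply: leq_sum => i _; apply: ltnW.
Qed.

Definition mcpl (N : nat) m : 'X_{1..n} := [multinom (N.-1 - m i)%N | i < n].

Lemma box_mcpl N m : (0 < N)%N -> box N (mcpl N m).
Proof. by move=> N_gt0; apply/boxP => i; rewrite mnmE; lia. Qed.

Lemma mcplK N m : box N m -> mcpl N (mcpl N m) = m.
Proof. by move/boxP=> box_m; apply/mnmP => i; rewrite !mnmE; have := box_m i; lia. Qed.

Lemma box_gt0 N m : box N m -> (0 < N)%N.
Proof. by move/boxP/(_ (Ordinal n_gt0)); case: N. Qed.

Lemma mdeg_mcpl N m : box N m -> ((mdeg (mcpl N m))%:Z = (n * N)%N%:Z - n%:Z - (mdeg m)%:Z).
Proof.
move=> box_m; have N_gt0 := box_gt0 box_m; move/boxP in box_m.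
suff : (mdeg (mcpl N m) + mdeg m + n = n * N)%N by lia.
rewrite !mdegE -big_split /=.
rewrite (eq_bigr (fun=> N.-1)); last by move=> i _; rewrite mnmE subnK //; have := box_m i; lia.
by rewrite sum_nat_const card_ord; nia.
Qed.

Definition mfact m : K := (\prod_i (m i)`!)%:R.

Lemma mfact_n0 m : mfact m != 0.
Proof.
rewrite /mfact char0_natr // -lt0n; apply: prodn_gt0 => i; exact: fact_gt0.
Qed.

Lemma mfactS m i : mfact (m + U_(i)) = mfact m *+ (m i).+1.
Proof.
rewrite /mfact -mulrnA; congr _%:R; rewrite (bigD1 i) // [in RHS](bigD1 i) //=.
rewrite mnmDE mnm1E eqxx addn1 factS -mulnA mulnC; congr (_ * _ * _)%N.
by apply: eq_bigr => j ne_ji; rewrite mnmDE mnm1E eq_sym (negPf ne_ji) addn0.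
Qed.

(** The fraction [p / (y_1 ... y_n) ^ N] modulo the fractions in which some
    [y_i] is missing from the denominator, written in divided powers
    [u ^ m / m!] standing for [y ^ (- m - 1)]: this turns multiplication by
    [y_i] into differentiation by [u_i]. *)
Definition residue (N : nat) p : T :=
  mpoly_of_coef (n * N).+1
    (fun m => if box N m then (mfact m)^-1 *: p@_(mcpl N m) else 0).

Lemma mcoeff_residue N p m :
  (residue N p)@_m = if box N m then (mfact m)^-1 *: p@_(mcpl N m) else 0.
Proof.
by rewrite mcoeff_of_coef // => m' lt_m; case: ifP => // /box_mdeg; lia.
Qed.

Fact residue_linear N : linear (residue N).
Proof.
move=> c p q; apply/mpolyP => m; rewrite (mcoeffD m (c *: residue N p)) (mcoeffZ c (residue N p)).
rewrite [LHS]mcoeff_residue (mcoeff_residue N p) (mcoeff_residue N q).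
case: ifP => _; last by rewrite mulr0 addr0.
by rewrite (mcoeffD _ (c *: p)) (mcoeffZ c p) scalerDr scalerAr.
Qed.
HB.instance Definition _ N :=
  GRing.isLinear.Build S T T *:%R (residue N) (residue_linear N).

Definition mones (t : nat) : 'X_{1..n} := [multinom t | i < n].

(** The residue only depends on the fraction. *)
Lemma residue_shift N t p : residue (N + t) ('X_[mones t] * p) = residue N p.
Proof.
apply/mpolyP => m; rewrite !mcoeff_residue mcoeff_monM.
have [box_m|nbox_m] := boolP (box N m).
  have /boxP box_mi := box_m.
  have -> : box (N + t) m by apply/boxP => i; rewrite ltn_addr.
  have -> : (mones t <= mcpl (N + t) m)%MM.
    by apply/mnm_lepP => i; rewrite !mnmE; have := box_mi i; lia.
  congr (_ *: _@_ _); apply/mnmP => i; rewrite mnmBE !mnmE; have := box_mi i; lia.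
case: ifP => // /boxP box_m; case: ifP => [/mnm_lepP le_t|_]; last by rewrite scaler0.
by case/negP: nbox_m; apply/boxP => i; have := le_t i; rewrite !mnmE; have := box_m i; lia.
Qed.

Lemma residue_missing N i q : residue N ('X_i ^+ N * q) = 0.
Proof.
apply/mpolyP => m; rewrite mcoeff_residue mcoeff0 mpolyXn mcoeff_monM.
case: ifP => // box_m; case: ifP => [/mnm_lepP/(_ i)|_]; last by rewrite scaler0.
by have := box_gt0 box_m; rewrite mulmnE mnm1E eqxx mnmE; lia.
Qed.

Lemma residueX N i p : residue N ('X_i * p) = (residue N p)^`M(i).
Proof.
apply/mpolyP => m; rewrite mcoeff_deriv !mcoeff_residue mcoeff_XM.
have [box_m|nbox_m] := boolP (box N m); last first.
  rewrite ifF ?mul0rn //; apply/negP => /boxP box_m; case/negP: nbox_m.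
  by apply/boxP => j; have := box_m j; rewrite mnmDE; apply: leq_ltn_trans; rewrite leq_addr.
have /boxP box_mi := box_m.
have [boxS|nboxS] := boolP (box N (m + U_(i))); last first.
  rewrite mul0rn ifT ?scaler0 //; rewrite mnmE subn_eq0.
  rewrite leqNgt; apply: contraNN nboxS => lt_i; apply/boxP => j; rewrite mnmDE mnm1E.
  by have := box_mi j; case: eqP lt_i => [<-|_]; lia.
rewrite ifF; last first.
  by have /boxP/(_ i) := boxS; rewrite mnmDE mnm1E eqxx mnmE; lia.
have -> : (mcpl N m - U_(i))%MM = mcpl N (m + U_(i)).
  by apply/mnmP => j; rewrite !mnmE subnDA.
rewrite scalerMnl; congr (_ *: _).
by rewrite mfactS -[mfact m *+ _]mulr_natr invfM -mulr_natr divfK ?char0_natr.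
Qed.

Lemma residue_flam lam N p : residue N (flam lam * p) = polar lam (residue N p).
Proof.
rewrite mulr_suml raddf_sum; apply: eq_bigr => i _ /=.
have -> : (lam i)%:MP%:MP * varx K i * vary K i * p = ((lam i)%:MP * 'X_i) *: ('X_i * p).
  by rewrite -mulrA -mpolyCM mul_mpolyC.
by rewrite linearZ /= residueX.
Qed.

Lemma residue_flamX lam N r p :
  residue N (flam lam ^+ r * p) = iter r (polar lam) (residue N p).
Proof.
elim: r p => [|r IHr] p; first by rewrite expr0 mul1r.
by rewrite exprS -mulrA residue_flam IHr.
Qed.

Definition fraction_of (N : nat) q : T :=
  mpoly_of_coef (n * N).+1
    (fun m => if box N m then mfact (mcpl N m) *: q@_(mcpl N m) else 0).

Lemma mcoeff_fraction_of N q m :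
  (fraction_of N q)@_m = if box N m then mfact (mcpl N m) *: q@_(mcpl N m) else 0.
Proof.
by rewrite mcoeff_of_coef // => m' lt_m; case: ifP => // /box_mdeg; lia.
Qed.

Fact fraction_of_linear N : linear (fraction_of N).
Proof.
move=> c p q; apply/mpolyP => m.
rewrite (mcoeffD m (c *: fraction_of N p)) (mcoeffZ c (fraction_of N p)).
rewrite [LHS]mcoeff_fraction_of (mcoeff_fraction_of N p) (mcoeff_fraction_of N q).
case: ifP => _; last by rewrite mulr0 addr0.
by rewrite (mcoeffD _ (c *: p)) (mcoeffZ c p) scalerDr scalerAr.
Qed.
HB.instance Definition _ N :=
  GRing.isLinear.Build S T T *:%R (fraction_of N) (fraction_of_linear N).

Lemma fraction_ofK N q :
  (forall m, q@_m != 0 -> box N m) -> residue N (fraction_of N q) = q.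
Proof.
move=> box_q; apply/mpolyP => m; rewrite mcoeff_residue; case: ifP => [box_m|/negP nbox_m].
  rewrite mcoeff_fraction_of box_mcpl ?(box_gt0 box_m) // mcplK //.
  by rewrite scalerA mulVf ?scale1r ?mfact_n0.
by apply/esym/eqP/negPn/negP => /box_q.
Qed.

Lemma fraction_of_msize q N : (msize q <= N)%N -> residue N (fraction_of N q) = q.
Proof.
move=> le_qN; apply: fraction_ofK => m; rewrite -mcoeff_msupp => /msize_mdeg_lt lt_m.
apply/boxP => i; apply: leq_trans le_qN; apply: leq_ltn_trans lt_m.
by rewrite mdegE (bigD1 i) //= leq_addr.
Qed.

Lemma bihomog_fraction_of a b N q : bihomog a b q ->
  bihomog a ((n * N)%N%:Z - n%:Z - b) (fraction_of N q).
Proof.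
move=> hq my mx; rewrite mcoeff_fraction_of; case: ifP => [box_my|_]; last first.
  by rewrite mcoeff0 eqxx.
rewrite mcoeffZ mulf_eq0 negb_or => /andP[_ /hq[-> <-]]; split=> //.
by rewrite mdeg_mcpl //; lia.
Qed.

Lemma bihomog_residue a b N p : bihomog a b p ->
  bihomog a ((n * N)%N%:Z - n%:Z - b) (residue N p).
Proof.
move=> hp my mx; rewrite mcoeff_residue; case: ifP => [box_my|_]; last first.
  by rewrite mcoeff0 eqxx.
rewrite mcoeffZ mulf_eq0 negb_or => /andP[_ /hp[-> <-]]; split=> //.
by rewrite mdeg_mcpl //; lia.
Qed.

(** The monomials outside the box are multiples of some [y_i ^ N]. *)
Lemma residue_eq0 N p : residue N p = 0 ->
  exists q : 'X_{1..n} -> 'I_n * T,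
    p = \sum_(m <- msupp p) 'X_((q m).1) ^+ N * (q m).2.
Proof.
move=> res0; suff h m : exists iq : 'I_n * T, p@_m *: 'X_[m] = 'X_(iq.1) ^+ N * iq.2.
  have /choice[q def_q] := h.
  by exists q; rewrite {1}[p]mpolyE; apply: eq_bigr => m _.
have [box_m|/boxP/existsNP[i /negP nlt_m]] := boolP (box N m).
  exists (Ordinal n_gt0, 0); rewrite mulr0.
  have /(congr1 (mcoeff (mcpl N m))) := res0.
  rewrite mcoeff_residue box_mcpl ?(box_gt0 box_m) // mcplK // mcoeff0 => /eqP.
  rewrite scaler_eq0 invr_eq0 (negPf (mfact_n0 _)) => /eqP ->.
  by rewrite scale0r.
exists (i, p@_m *: 'X_[m - U_(i) *+ N]); rewrite -scalerAr mpolyXn -mpolyXD addmC submK //.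
apply/mnm_lepP => j; rewrite mulmnE mnm1E; case: eqP => [<-|_]; last by rewrite mul0n.
by rewrite mul1n leqNgt.
Qed.

End InverseSystem.

(** * Fractions and Cech cochains *)

Section Fractions.
Variables (R : comNzRingType) (M : lmodType R).
Implicit Types (s t : R) (x y : M).

Lemma frac_shift s l x k : frac s x k = frac s (s ^+ l *: x) (k + l).
Proof. by apply/fracP; exists 0%N; rewrite !add0n scalerX addnC. Qed.

Lemma fracD s x y k : frac s x k + frac s y k = frac s (x + y) k.
Proof.
rewrite [LHS]loc_addE -scalerDr [RHS](frac_shift s k) //.
Qed.

Lemma frac0 s k : frac s (0 : M) k = 0.
Proof. by apply/fracP; exists 0%N; rewrite !scaler0. Qed.

Lemma fracZ s a x k : a *: frac s x k = frac s (a *: x) k.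
Proof. exact: loc_scaleE. Qed.

Lemma frac_sum s I (r : seq I) (F : I -> M) k :
  \sum_(i <- r) frac s (F i) k = frac s (\sum_(i <- r) F i) k.
Proof.
elim: r => [|i r IHr]; first by rewrite !big_nil frac0.
by rewrite !big_cons IHr fracD.
Qed.

Lemma locmap_fracE s t s' x k :
  s' = t * s -> locmap t s' (frac s x k) = frac s' (t ^+ k *: x) k.
Proof. by move=> ->; apply: locmap_frac. Qed.

Lemma locmap0 s t s' : s' = t * s -> locmap t s' (0 : loc M s) = 0.
Proof. by move=> def_s'; rewrite -(frac0 s 0) locmap_fracE // scaler0 frac0. Qed.

Lemma locmapD s t s' (u v : loc M s) : s' = t * s ->
  locmap t s' (u + v) = locmap t s' u + locmap t s' v.
Proof.
move=> def_s'; elim/frac_ind: u => x k; elim/frac_ind: v => y l.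
have -> : frac s x k + frac s y l = frac s (s ^+ l *: x + s ^+ k *: y) (k + l).
  exact: loc_addE.
rewrite !locmap_fracE // [RHS]loc_addE scalerDr def_s' !exprMn !scalerA.
congr (frac _ (_ *: _ + _ *: _) _); rewrite exprD; ring.
Qed.

Lemma locmapZ s t s' a (u : loc M s) : s' = t * s ->
  locmap t s' (a *: u) = a *: locmap t s' u.
Proof.
move=> def_s'; elim/frac_ind: u => x k.
by rewrite fracZ !locmap_fracE // fracZ !scalerA mulrC.
Qed.

End Fractions.

Section CechCoboundary.
Variables (R : comNzRingType) (n : nat) (y : 'I_n -> R) (M : lmodType R).

Lemma yprodD1 (A : {set 'I_n}) i : i \in A -> yprod y A = y i * yprod y (A :\ i).
Proof. exact: big_setD1. Qed.

Lemma cech_eq (c c' : cech y M) : (forall A, c A = c' A) -> c = c'.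
Proof. exact: functional_extensionality_dep. Qed.

Lemma cech_diffD (b c : cech y M) : cech_diff (b + c) = cech_diff b + cech_diff c.
Proof.
apply: cech_eq => A; apply: etrans (big_split _ _ _ _ _).
by apply: eq_bigr => i Ai; rewrite /= -scalerDr -locmapD //; apply: yprodD1.
Qed.

Lemma cech_diffZ a (c : cech y M) : cech_diff (a *: c) = a *: cech_diff c.
Proof.
apply: cech_eq => A; apply: etrans (esym (scaler_sumr _ _ _ _)).
apply: eq_bigr => i Ai.
have -> : (a *: c) (A :\ i) = a *: c (A :\ i) by [].
rewrite locmapZ; last exact: yprodD1.
by rewrite [LHS]scalerA [RHS]scalerA mulrC.
Qed.

Lemma cech_diff_eq0 (c : cech y M) (A : {set 'I_n}) : (forall i, i \in A -> c (A :\ i) = 0) ->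
  cech_diff c A = 0.
Proof.
move=> c0; apply: big1 => i Ai; rewrite c0 // locmap0 ?scaler0 //.
exact: yprodD1.
Qed.

Lemma cech_diff0 : cech_diff (0 : cech y M) = 0.
Proof. by apply: cech_eq => A; apply: cech_diff_eq0. Qed.

Lemma coboundary_span k (c : cech y M) :
  (0 < k)%N -> span (fun b : cech y M => coboundary k b) c -> coboundary k c.
Proof.
case: k => // k _; elim=> [|b kb|b c' _ [l [b1 [lk hb1 ->]]] _ [l' [b2 [lk' hb2 ->]]]|a b _].
- by exists k, 0; rewrite cech_diff0.
- exact: kb.
- case: lk lk' hb1 hb2 => -> [->] hb1 hb2; exists k, (b1 + b2); rewrite cech_diffD; split=> // A kA.
  by apply: etrans (congr2 _ (hb1 A kA) (hb2 A kA)) (addr0 _).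
- move=> [l [b1 [lk hb1 ->]]]; exists l, (a *: b1); rewrite cech_diffZ; split=> // A kA.
  by apply: etrans (congr1 _ (hb1 A kA)) (scaler0 _ _).
Qed.

End CechCoboundary.

(** * Top local cohomology of the quotient by a polynomial *)

Section TopCohomology.
Variables (K : fieldType) (n : nat).
Hypothesis charK : [pchar K] =i pred0.
Hypothesis n_gt0 : (0 < n)%N.
Variables (lam : 'I_n -> K) (r : nat).
Local Notation S := {mpoly K[n]}.
Local Notation T := {mpoly S[n]}.
Local Notation g := (flam lam ^+ r).
Local Notation M := (bigr_quot g).
Local Notation E := (polar lam).
Local Notation full := [set: 'I_n].
Local Notation Y := (yprod (@vary K n)).
Implicit Types (p q : T) (N : nat).

Definition modg p : M := quotpi (fun h : T^o => h = g) (p : T^o).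

Lemma modg_eq p q : modg p = modg q <-> exists h, p - q = g * h.
Proof.
rewrite /modg; split=> [/quotpiP|[h eq_pq]]; last first.
  apply/quotpiP; rewrite [X in span _ X](_ : _ = h *: (g : T^o)).
    by apply: spanZ; apply: span_mem.
  by rewrite [LHS]eq_pq mulrC.
elim=> [|x ->|x x' _ [h ->] _ [h' ->]|a x _ [h ->]].
- by exists 0; rewrite mulr0.
- by exists 1; rewrite mulr1.
- by exists (h + h'); rewrite mulrDr.
- by exists (a * h); rewrite mulrCA.
Qed.

Lemma modgD p q : modg (p + q) = modg p + modg q.
Proof. by rewrite [RHS]quot_addE. Qed.

Lemma modgZ a p : modg (a * p) = a *: modg p.
Proof. by rewrite [RHS]quot_scaleE. Qed.

Lemma modg_sum I (s : seq I) (F : I -> T) :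
  modg (\sum_(i <- s) F i) = \sum_(i <- s) modg (F i).
Proof.
elim: s => [|i s IHs]; last by rewrite !big_cons modgD IHs.
by rewrite !big_nil.
Qed.

Definition top_cochain N p : cech (@vary K n) M :=
  fun A => if A == full then frac (Y A) (modg p) N else 0.

Lemma top_cochain_full N p : top_cochain N p full = frac (Y full) (modg p) N.
Proof. by rewrite /top_cochain eqxx. Qed.

Lemma cochain_top (c : cech (@vary K n) M) N p :
  cochain n c -> c full = frac (Y full) (modg p) N -> c = top_cochain N p.
Proof.
move=> hc def_c; apply: cech_eq => A; rewrite /top_cochain; case: eqP => [->//|ne_A].
apply: hc => cardA; apply: ne_A; apply/eqP; rewrite eqEcard subsetT /=.
by rewrite cardsT card_ord cardA.
Qed.

Lemma cocycle_top N p : cocycle n (top_cochain N p).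
Proof.
split=> [A|]; first by rewrite /top_cochain; case: eqP => // ->; rewrite cardsT card_ord.
apply: cech_eq => A; apply: cech_diff_eq0 => i Ai; rewrite /top_cochain.
by case: eqP => // /setP/(_ i); rewrite !inE eqxx.
Qed.

Definition top_class N p : loccoh n M :=
  quotpi (fun c : cech (@vary K n) M => coboundary n c) (top_cochain N p).

Lemma top_cochainD N p q : top_cochain N (p + q) = top_cochain N p + top_cochain N q.
Proof.
apply: cech_eq => A; rewrite [RHS]/(top_cochain N p A + top_cochain N q A) /top_cochain.
case: ifP => _; last exact: esym (addr0 _).
by rewrite modgD; apply: esym (fracD _ _ _ _).
Qed.

Lemma top_cochainZ N a p : top_cochain N (a * p) = a *: top_cochain N p.
Proof.
apply: cech_eq => A; rewrite [RHS]/(a *: top_cochain N p A) /top_cochain.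
case: ifP => _; last exact: esym (scaler0 _ _).
by rewrite modgZ; apply: esym (fracZ _ _ _ _).
Qed.

Lemma top_classD N p q : top_class N (p + q) = top_class N p + top_class N q.
Proof. by rewrite [RHS]quot_addE /top_class top_cochainD. Qed.

Lemma top_classZ N a p : top_class N (a * p) = a *: top_class N p.
Proof. by rewrite [RHS]quot_scaleE /top_class top_cochainZ. Qed.

Lemma top_class0 N : top_class N 0 = 0.
Proof. by rewrite -[0 in LHS](mul0r 0) top_classZ scale0r. Qed.

Lemma top_class_sum N I (s : seq I) (F : I -> T) :
  top_class N (\sum_(i <- s) F i) = \sum_(i <- s) top_class N (F i).
Proof.
elim: s => [|i s IHs]; last by rewrite !big_cons top_classD IHs.
by rewrite !big_nil top_class0.
Qed.

Lemma Y_full : Y full = 'X_[mones n 1].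
Proof.
rewrite /yprod mpolyXE_id; apply: eq_big => [i|i _]; first by rewrite inE.
by rewrite mnmE expr1.
Qed.

Lemma Y_fullX t : Y full ^+ t = 'X_[mones n t].
Proof.
by rewrite Y_full mpolyXn; congr 'X_[_]; apply/mnmP => i; rewrite mulmnE !mnmE mul1n.
Qed.

Lemma top_class_shift N t p : top_class N p = top_class (N + t) ('X_[mones n t] * p).
Proof.
congr (quotpi _ _); apply: cech_eq => A; rewrite /top_cochain; case: eqP => // ->.
by rewrite modgZ -Y_fullX -frac_shift.
Qed.

Lemma top_class_g N p : top_class N (g * p) = 0.
Proof.
rewrite -(top_class0 N); congr (quotpi _ _); apply: cech_eq => A.
rewrite /top_cochain; case: eqP => // _; congr frac.
by apply/modg_eq; exists p; rewrite subr0.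
Qed.

Lemma full_D1 (A : {set 'I_n}) i j : j \in A -> (A :\ j == [set~ i]) = (A == full) && (j == i).
Proof.
move=> Aj; apply/eqP/andP => [eqA|[/eqP -> /eqP ->]]; last by rewrite setTD.
have ij : j = i.
  by apply/eqP; have := setD11 j A; rewrite eqA !inE => /negbFE.
by rewrite -(setD1K Aj) eqA ij setUCr.
Qed.

(** A fraction in which [y_i] does not occur in the denominator comes from the
    localization at the product of the other variables. *)
Lemma top_class_missing N i q : top_class N ('X_i ^+ N * q) = 0.
Proof.
pose sgn : T := (-1) ^+ #|[set j in full | (j < i)%N]|.
pose b : cech (@vary K n) M := fun A =>
  if A == [set~ i] then sgn *: frac (Y A) (modg q) N else 0.
apply/quotpiP; rewrite subr0; apply: span_mem; exists n.-1, b; split.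
- by rewrite prednK.
- move=> A cardA; rewrite /b; case: eqP => // eqA; case: cardA.
  by rewrite eqA cardsC1 card_ord.
apply: cech_eq => A; rewrite /top_cochain; case: eqP => [->|ne_A]; last first.
  rewrite cech_diff_eq0 // => j Aj; rewrite /b full_D1 //.
  by case: eqP.
rewrite /cech_diff (bigD1 i) ?inE //= big1 ?addr0 => [|j /andP[_ ne_ji]]; last first.
  by rewrite /b full_D1 ?inE // eqxx (negPf ne_ji) locmap0 ?scaler0 //; apply: yprodD1; rewrite inE.
rewrite /b full_D1 ?inE // !eqxx /= locmapZ; last by apply: yprodD1; rewrite inE.
rewrite locmap_fracE; last by apply: yprodD1; rewrite inE.
by rewrite scalerA -exprMn mulN1r opprK expr1n scale1r modgZ.
Qed.

Lemma top_class_residue0 N p : residue N p = 0 -> top_class N p = 0.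
Proof.
case/(residue_eq0 charK n_gt0) => q ->; rewrite top_class_sum big1 // => m _.
exact: top_class_missing.
Qed.

Let exprM_shift (A : comNzRingType) (a b c : A) k l :
  (a * b) ^+ l * (a ^+ k * c) = a ^+ (k + l) * (b ^+ l * c).
Proof. by rewrite exprMn mulrACA -exprD addnC. Qed.

(** A coboundary is a sum of fractions each of which misses some [y_i] in its
    denominator, and these have no residue. Over a common denominator the vanishing
    of the class thus equates a multiple of the numerator with one of [g], up to
    numerators without residue. *)
Lemma coboundary_residue N p : top_class N p = 0 -> exists h, residue N p = iter r E h.
Proof.
move/quotpiP; rewrite subr0 => /(coboundary_span n_gt0)[l [b [_ _ def_c]]].
have /choice[q def_q] i : exists qk : T * nat,
    locmap (vary K i) (Y full) (b (full :\ i)) = frac (Y full) (modg ('X_i ^+ qk.2 * qk.1)) qk.2.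
  exists (quotrepr (locrepr (b (full :\ i))).1, (locrepr (b (full :\ i))).2).
  by rewrite /locmap modgZ /modg quotreprK.
pose L := (\sum_i (q i).2)%N.
have le_L i : ((q i).2 <= L)%N by rewrite /L (bigD1 i) //= leq_addr.
pose Q : T := \sum_(i < n) (-1) ^+ #|[set j in full | (j < i)%N]| *
   ('X_i ^+ L * (Y (full :\ i) ^+ (L - (q i).2) * (q i).1)).
have def_f : frac (Y full) (modg p) N = frac (Y full) (modg Q) L.
  rewrite -top_cochain_full def_c /cech_diff [LHS](eq_bigl xpredT) => [|i]; last by rewrite inE.
  rewrite /Q modg_sum -frac_sum; apply: eq_bigr => i _.
  rewrite modgZ -fracZ def_q; congr (_ *: _).
  rewrite -[in RHS](subnKC (le_L i)) addKn.
  apply: etrans (frac_shift _ (L - (q i).2)%N _ _) _; rewrite -modgZ.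
  have -> : Y full = 'X_i * Y (full :\ i) by apply: yprodD1; rewrite inE.
  have := exprM_shift ('X_i : T) (Y (full :\ i)) (q i).1 (q i).2 (L - (q i).2).
  exact: (congr1 (fun z => frac _ (modg z) _)).
have [t /= eq_t] := (fracP _ _ _ _ _).1 def_f.
have [h def_h] : exists h, Y full ^+ (t + L) * p - Y full ^+ (t + N) * Q = g * h.
  by apply/modg_eq; rewrite !modgZ.
have resQ : residue L Q = 0.
  rewrite raddf_sum; apply: big1 => i _ /=; rewrite mulrCA; exact: (residue_missing n_gt0).
exists (residue (N + (t + L)) h); rewrite -(residue_flamX charK n_gt0) -def_h !Y_fullX.
rewrite [RHS]raddfB /= (residue_shift n_gt0).
have -> : (N + (t + L) = L + (t + N))%N by lia.
by rewrite (residue_shift n_gt0) resQ subr0.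
Qed.

End TopCohomology.

(** * Homogeneous components and polarization *)

Section Components.
Variables (K : fieldType) (n : nat) (lam : 'I_n -> K).
Local Notation S := {mpoly K[n]}.
Local Notation T := {mpoly S[n]}.
Local Notation E := (polar lam).
Implicit Types (p q : T) (a b : int).

(** The component of degree [a] in the [x_i]; the one in the [u_i] is given by
    [mhomog_comp]. *)
Definition xcomp a p : T :=
  mpoly_of_coef (msize p) (fun m => mhomog_comp a p@_m).

Lemma mcoeff_xcomp a p m : (xcomp a p)@_m = mhomog_comp a p@_m.
Proof. by rewrite mcoeff_of_coef // => m' /mcoeff_msize ->; apply: mhomog_comp0. Qed.

Lemma mcoeff_polar p m :
  (E p)@_m = \sum_i ((lam i)%:MP * 'X_i) * (p@_(m + U_(i)) *+ (m i).+1).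
Proof.
rewrite /polar raddf_sum; apply: eq_bigr => i _ /=.
by rewrite mcoeffZ mcoeff_deriv.
Qed.

Let mhomog_compXMn a i (c : K) (s : S) k :
  mhomog_comp (a + 1) ((c%:MP * 'X_i) * (s *+ k)) = (c%:MP * 'X_i) * (mhomog_comp a s *+ k).
Proof.
have hcX : xhomog 1 (c%:MP * 'X_i : S).
  by rewrite -[1]add0r; apply: xhomogM; [apply: xhomogC|apply: xhomogX].
rewrite mulrC (mhomog_compMr _ _ hcX) mulrC addrK; congr (_ * _).
rewrite -mulr_natr -mpolyC_nat (mhomog_compMr _ _ (@xhomogC K n _)) subr0.
by rewrite mpolyC_nat mulr_natr.
Qed.

Lemma xcomp_polar a p : xcomp (a + 1) (E p) = E (xcomp a p).
Proof.
move def_q: (xcomp a p) => q; apply/mpolyP => m.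
rewrite [LHS]mcoeff_xcomp; apply: etrans (congr1 _ (mcoeff_polar p m)) _.
apply: etrans (esym (mcoeff_polar q m)); rewrite mhomog_comp_sum.
by apply: eq_bigr => i _; rewrite mhomog_compXMn -def_q mcoeff_xcomp.
Qed.

Lemma ycomp_polar b p : mhomog_comp (b - 1) (E p) = E (mhomog_comp b p).
Proof.
move def_q: (mhomog_comp b p) => q; apply/mpolyP => m.
rewrite [LHS]mcoeff_homog_comp; apply: etrans (esym (mcoeff_polar q m)).
rewrite mcoeff_polar.
case: eqP => [eq_m|ne_m].
  apply: eq_bigr => i _; rewrite -def_q mcoeff_homog_comp ifT //.
  by rewrite mdegD mdeg1; lia.
apply/esym; apply: big1 => i _; rewrite -def_q mcoeff_homog_comp ifF ?mul0rn ?mulr0 //.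
by apply/eqP; rewrite mdegD mdeg1; lia.
Qed.

Lemma xcomp_iter_polar k a p : xcomp (a + k%:Z) (iter k E p) = iter k E (xcomp a p).
Proof.
elim: k => [|k IHk]; first by rewrite addr0.
by rewrite !iterS -IHk -xcomp_polar; congr xcomp; lia.
Qed.

Lemma ycomp_iter_polar k b p :
  mhomog_comp (b - k%:Z) (iter k E p) = iter k E (mhomog_comp b p).
Proof.
elim: k => [|k IHk]; first by rewrite subr0.
by rewrite !iterS -IHk -ycomp_polar; congr mhomog_comp; lia.
Qed.

Lemma bihomog_comp a b p : bihomog a b (xcomp a (mhomog_comp b p)).
Proof.
move=> my mx; rewrite mcoeff_xcomp mcoeff_homog_comp mcoeff_homog_comp.
case: (_ =P a) => [<-|_]; last by rewrite eqxx.
by case: (_ =P b) => [<-|_] //; rewrite mcoeff0 eqxx.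
Qed.

Lemma comp_bihomog a b p : bihomog a b p -> xcomp a (mhomog_comp b p) = p.
Proof.
move=> hp; apply/mpolyP => my; apply/mpolyP => mx.
rewrite mcoeff_xcomp !mcoeff_homog_comp.
have [p0|nz] := eqVneq (p@_my)@_mx 0; last by have [-> ->] := hp _ _ nz; rewrite !eqxx.
by case: ifP => // _; case: ifP => _; rewrite ?mcoeff0.
Qed.

Lemma coef0_polar p m : ((E p)@_m)@_0%MM = 0.
Proof.
rewrite mcoeff_polar raddf_sum; apply: big1 => i _ /=.
by rewrite -mulrA mcoeffCM mcoeff_XM mnm0E mulr0.
Qed.

End Components.

(** * The graded components of top local cohomology *)

Section TopComponents.
Variables (K : fieldType) (n : nat).
Hypothesis charK : [pchar K] =i pred0.
Hypothesis n_gt0 : (0 < n)%N.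
Variables (lam : 'I_n -> K) (r : nat).
Local Notation S := {mpoly K[n]}.
Local Notation T := {mpoly S[n]}.
Local Notation g := (flam lam ^+ r).
Local Notation M := (bigr_quot g).
Local Notation E := (polar lam).
Local Notation H := (loccoh n M).
Implicit Types (p q : T) (N : nat).

Lemma top_class_eq N N' p p' : residue N p = residue N' p' ->
  top_class lam r N p = top_class lam r N' p'.
Proof.
move=> eq_res; rewrite (top_class_shift _ _ N N') (top_class_shift _ _ N' N) addnC.
apply/eqP; rewrite -subr_eq0 -scaleN1r -top_classZ -top_classD mulN1r; apply/eqP.
apply: top_class_residue0 => //; rewrite raddfB /=.
by rewrite residue_shift // addnC residue_shift // eq_res subrr.
Qed.

Lemma top_class_comp N p (a b : int) :
  bihomog a (b + (N * n)%N%:Z) p -> @bigr_comp _ H a b (top_class lam r N p).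
Proof.
move=> hp; exists (top_cochain lam r N p); split=> //; first exact: cocycle_top.
move=> A; rewrite /top_cochain; case: eqP => [->|_].
  by exists (modg lam r p), N; split=> //; exists p => //; rewrite cardsT card_ord.
exists (modg lam r 0), 0%N; split; last by rewrite frac0.
by exists 0 => //; apply: bihomog0.
Qed.

Lemma comp_top_class (a b : int) z : @bigr_comp _ H a b z ->
  exists N p, bihomog a (b + (N * n)%N%:Z) p /\ z = top_class lam r N p.
Proof.
move=> [c [[hc _] /(_ [set: 'I_n])[x [k [[p hp ->] def_c]]] ->]].
rewrite cardsT card_ord in hp; exists k, p; split=> //.
by congr (quotpi _ _); apply: cochain_top hc def_c.
Qed.

Variable d : nat.
Local Notation ind := {m : 'X_{1..n < d.+1} | mdeg m == d}.
Local Notation b := #|{: ind}|.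

Definition mon (k : 'I_b) : 'X_{1..n} := val (val (enum_val k)).

(** Row vectors are the coefficients of the polynomials of degree [d] in the
    [u_i]. *)
Definition dpoly (v : 'rV[S]_b) : T := \sum_k v 0 k *: 'X_[mon k].

Definition dcoef (q : T) : 'rV[S]_b := \row_k q@_(mon k).

Lemma mdeg_mon k : mdeg (mon k) = d.
Proof. exact: (eqP (valP (enum_val k))). Qed.

Lemma mon_inj : injective mon.
Proof. by move=> k k' /val_inj/val_inj/enum_val_inj. Qed.

Lemma mon_onto m : mdeg m = d -> exists k, mon k = m.
Proof.
move=> dm; have lt_m : (mdeg m < d.+1)%N by rewrite dm.
have dm' : mdeg (BMultinom lt_m) == d by apply/eqP.
by exists (enum_rank (Sub (BMultinom lt_m) dm' : ind)); rewrite /mon enum_rankK.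
Qed.

Lemma mcoeff_dpoly v k : (dpoly v)@_(mon k) = v 0 k.
Proof.
rewrite raddf_sum (bigD1 k) //= mcoeffZ mcoeffX eqxx mulr1 big1 ?addr0 // => l ne_lk.
by rewrite mcoeffZ mcoeffX (inj_eq mon_inj) (negPf ne_lk) mulr0.
Qed.

Lemma mcoeff_dpoly0 v m : mdeg m != d -> (dpoly v)@_m = 0.
Proof.
move=> ne_d; rewrite raddf_sum big1 // => k _ /=; rewrite mcoeffZ mcoeffX.
case: (mon k =P m) => [def_m|_]; last by rewrite mulr0.
by case/negP: ne_d; rewrite -def_m mdeg_mon.
Qed.

Lemma dcoefK a q : bihomog a d%:Z q -> dpoly (dcoef q) = q.
Proof.
move=> hq; apply/mpolyP => m; have [/mon_onto[k <-]|ne_d] := eqVneq (mdeg m) d.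
  by rewrite mcoeff_dpoly mxE.
rewrite mcoeff_dpoly0 //; apply/mpolyP => mx; apply/esym/eqP; rewrite mcoeff0.
by apply: contraNT ne_d => /hq[_ /eqP]; rewrite eqz_nat.
Qed.

Lemma bihomog_dpoly a v : vhomog (fun=> 0) a v -> bihomog a d%:Z (dpoly v).
Proof.
move=> hv my mx; have [/mon_onto[k <-]|ne_d] := eqVneq (mdeg my) d; last first.
  by rewrite mcoeff_dpoly0 // mcoeff0 eqxx.
by rewrite mcoeff_dpoly mdeg_mon => nz; split=> //; have /xhomogP := hv k; rewrite subr0; apply.
Qed.

Lemma vhomog_dcoef a q : bihomog a d%:Z q -> vhomog (fun=> 0) a (dcoef q).
Proof.
by move=> hq k; rewrite subr0; apply/xhomogP => m; rewrite mxE => /hq[].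
Qed.

Lemma dpolyD u v : dpoly (u + v) = dpoly u + dpoly v.
Proof. by rewrite -big_split; apply: eq_bigr => k _; rewrite mxE scalerDl. Qed.

Lemma dpolyZ c v : dpoly (c *: v) = c *: dpoly v.
Proof. by rewrite scaler_sumr; apply: eq_bigr => k _; rewrite mxE scalerA. Qed.

Lemma dpoly_comp a v : dpoly (vcomp (fun=> 0) a v) = xcomp a (dpoly v).
Proof.
apply/mpolyP => m; rewrite mcoeff_xcomp.
have [/mon_onto[k <-]|ne_d] := eqVneq (mdeg m) d.
  by rewrite !mcoeff_dpoly mxE subr0.
by rewrite !mcoeff_dpoly0 // mhomog_comp0.
Qed.

Lemma box_mon k : box d.+1 (mon k).
Proof.
apply/boxP => i; rewrite ltnS; have le_i : (mon k i <= mdeg (mon k))%N.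
  by rewrite mdegE (bigD1 i) //= leq_addr.
by rewrite (leq_trans le_i) // mdeg_mon.
Qed.

Lemma residue_dpoly v : residue d.+1 (fraction_of d.+1 (dpoly v)) = dpoly v.
Proof.
apply: fraction_ofK => // m.
have [/mon_onto[k <-] _|ne_d] := eqVneq (mdeg m) d; first exact: box_mon.
by rewrite mcoeff_dpoly0 // eqxx.
Qed.

Definition top_gen (j : int) (k : 'I_b) : ydegree H j :=
  top_class lam r d.+1 (fraction_of d.+1 'X_[mon k]).

Lemma top_genE j (v : 'rV[S]_b) :
  \sum_k v 0 k *: top_gen j k = top_class lam r d.+1 (fraction_of d.+1 (dpoly v)).
Proof.
rewrite raddf_sum; apply: etrans (esym (top_class_sum _ _ _ _ _)).
by apply: eq_bigr => k _ /=; rewrite linearZ /= -mul_mpolyC top_classZ.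
Qed.

Definition rel_sub (v : 'rV[S]_b) := exists h, dpoly v = iter r E h.

(** Classes are equal when their residues are, and multiples of [f^r] have as
    residues the images of [E^r]: the component is the cokernel of [E^r]. *)
Lemma top_gen_rel j (v : 'rV[S]_b) : \sum_k v 0 k *: top_gen j k = 0 <-> rel_sub v.
Proof.
rewrite top_genE; split=> [|[h def_v]].
  by move/(coboundary_residue charK n_gt0); rewrite residue_dpoly.
have def_h : residue (msize h) (fraction_of (msize h) h) = h by apply: fraction_of_msize.
rewrite -(top_class_g lam r (msize h) (fraction_of (msize h) h)).
by apply: top_class_eq; rewrite residue_dpoly residue_flamX // def_h.
Qed.

Lemma graded_rel_sub : graded_submod (fun=> 0) rel_sub.
Proof.
split=> [|u v|c v|a v].
- by exists 0; rewrite iter_raddf0 /dpoly big1 // => k _; rewrite mxE scale0r.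
- by move=> [h hu] [h' hv]; exists (h + h'); rewrite dpolyD iter_raddfD hu hv.
- move=> [h hv]; exists (c *: h); rewrite dpolyZ hv.
  by elim: (r) => [//|k IHk]; rewrite !iterS -IHk linearZ.
- move=> [h hv]; exists (xcomp (a - r%:Z) h).
  by rewrite dpoly_comp hv -xcomp_iter_polar subrK.
Qed.

Hypothesis lam_n0 : forall i, lam i != 0.
Hypothesis n_ge2 : (2 <= n)%N.
Hypothesis r_gt0 : (0 < r)%N.

Lemma rel_sub_coef0 v : rel_sub v -> forall k, (v 0 k)@_0%MM = 0.
Proof.
by case=> h hv k; rewrite -mcoeff_dpoly hv -(prednK r_gt0) iterS coef0_polar.
Qed.

(** Vectors of degree [a] have weight [a - d], which is at least [r] here. *)
Lemma rel_sub_high a v : (d + r.-1)%N%:Z < a -> vhomog (fun=> 0) a v -> rel_sub v.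
Proof.
move=> lt_a /bihomog_dpoly hv.
have [|h _ def_v] := sl2_surj (polar_sl2 charK lam_n0) (r := r) hv; last by exists h.
by move: lt_a; lia.
Qed.

(** A highest weight vector of weight [r - 1]; a preimage under [E^r] may be
    replaced by its bihomogeneous component. *)
Lemma rel_sub_socle : exists2 v, vhomog (fun=> 0) (d + r.-1)%N%:Z v & ~ rel_sub v.
Proof.
pose i := Ordinal n_gt0; pose j := Ordinal n_ge2.
have ne_ij : i != j by [].
have [w [hw Ew w_n0]] := polar_highest lam_n0 d r.-1 ne_ij.
exists (dcoef w); first exact: vhomog_dcoef.
rewrite /rel_sub (dcoefK hw) => -[h def_w]; case/eqP: w_n0.
pose h' := xcomp ((d + r.-1)%N%:Z - r%:Z) (mhomog_comp (d + r)%N%:Z h).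
apply: (sl2_not_image (polar_sl2 charK lam_n0) (r := r) hw Ew (v := h')).
- by lia.
- by rewrite -PoszD; apply: bihomog_comp.
rewrite -xcomp_iter_polar subrK -ycomp_iter_polar -def_w.
have -> : (d + r)%N%:Z - r%:Z = d%:Z by lia.
exact: comp_bihomog.
Qed.

Lemma has_reg_top : has_reg (ydegree H (- n%:Z - d%:Z)) (d + r.-1)%N%:Z.
Proof.
have relE v := top_gen_rel (- n%:Z - d%:Z) v.
apply: (@has_reg_finite_length K n _ _ (top_gen (- n%:Z - d%:Z))).
- exact: n_gt0.
- move=> k; apply: top_class_comp.
  have -> : - n%:Z - d%:Z + (d.+1 * n)%N%:Z = (n * d.+1)%N%:Z - n%:Z - d%:Z by lia.
  apply: bihomog_fraction_of => // my mx; rewrite mcoeffX.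
  case: (mon k =P my) => [<-|_]; last by rewrite mcoeff0 eqxx.
  by rewrite mdeg_mon mcoeff1; case: (mx =P 0%MM) => [->|_]; rewrite ?mdeg0 // eqxx.
- move=> a z /comp_top_class[N [p [hp ->]]]; have := bihomog_residue n_gt0 (N := N) hp.
  have -> : (n * N)%N%:Z - n%:Z - (- n%:Z - d%:Z + (N * n)%N%:Z) = d%:Z by lia.
  move=> hres; exists (dcoef (residue N p)); rewrite top_genE.
  by apply: top_class_eq; rewrite residue_dpoly (dcoefK hres).
- have [g0 gD gZ gC] := graded_rel_sub.
  split=> [|u v|c v|a v]; first exact/relE.
  + by move=> /relE hu /relE hv; apply/relE/gD.
  + by move=> /relE hv; apply/relE/gZ.
  + by move=> /relE hv; apply/relE/gC.
- by move=> v /relE; apply: rel_sub_coef0.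
- by move=> a v lt_a hv; apply/relE; apply: rel_sub_high hv.
- by have [v hv nv] := rel_sub_socle; exists v => // /relE.
Qed.

End TopComponents.

Theorem theorem4p1 (K : fieldType) (charK : [pchar K] =i pred0) (n : nat)
    (n_ge2 : (2 <= n)%N) (r : nat) (r_ge1 : (1 <= r)%N) :
  exists V : ('I_n -> K) -> Prop,
    [/\ zariski_open V, (exists lam, V lam) &
      forall lam, V lam -> forall j : int, j <= - n%:Z ->
        has_reg (ydegree (loccoh n (bigr_quot (flam lam ^+ r))) j)
                (- n%:Z - j + r%:Z - 1)].
Proof.
(* the complement of the coordinate hyperplanes *)
exists (fun lam => forall i, lam i != 0); split.
- exists (fun p => p = \prod_i 'X_i) => lam; split=> [lam_n0|[_ ->]].
    exists (\prod_i 'X_i) => //; rewrite rmorph_prod /=.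
    by apply/prodf_neq0 => i _; rewrite mevalXU.
  by rewrite rmorph_prod /= => /prodf_neq0 nz i; have := nz i isT; rewrite mevalXU.
- by exists (fun=> 1) => i; apply: oner_neq0.
move=> lam lam_n0 j le_j; have n_gt0 : (0 < n)%N by apply: ltnW.
have [d ->] : exists d : nat, j = - n%:Z - d%:Z.
  by exists `|- n%:Z - j|%N; lia.
have -> : - n%:Z - (- n%:Z - d%:Z) + r%:Z - 1 = (d + r.-1)%N%:Z by lia.
exact: has_reg_top.
Qed.
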